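(* For every $\alpha>0$ there exist $\beta\in(0,1)$, a constant $C>0$, an infinite set $K\subseteq\mathbb{N}$, and a function $\varepsilon:K\to[0,1]$ with $\varepsilon(k)\to 0$ as $k\to\infty$ in $K$, such that for every $k\in K$ and every $N\in\mathbb{N}$ there exists a finite $k$-regular graph $G$ with $|V(G)|\ge N$ for which, with probability at least $1-\varepsilon(k)$, the following holds: every induced subgraph $H$ of $G_{1/2}$ with minimum degree $\delta(H)\ge k/4+\alpha k$ satisfies $$\frac{|V(H)|}{|V(G)|}\le C(1-\beta)^{k^2}.$$
   Context: Graphs are simple and undirected. For a graph $G$ and $p\in(0,1)$, $G_p$ denotes the random subgraph of $G$ on the same vertex set obtained by including each edge of $G$ independently with probability $p$. $\delta(H)$ denotes the minimum degree of $H$. *)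

(* Defs.v *)
From HB Require Import structures.
From mathcomp Require Import all_boot all_order all_algebra.

Set Implicit Arguments.
Unset Strict Implicit.
Unset Printing Implicit Defensive.

Import Order.TTheory GRing.Theory Num.Theory.
Local Open Scope ring_scope.

Record sgraph := SGraph {
  vertex :> finType;
  adj : rel vertex;
  adj_sym : symmetric adj;
  adj_irr : irreflexive adj }.

Definition degree (G : sgraph) (x : G) : nat := #|[set y | adj x y]|.

Definition regular_graph (k : nat) (G : sgraph) : Prop :=
  forall x : G, degree x = k.

(* Every degree is below #|G|, so the default value is not attained unless G
   has no vertex, in which case the minimum degree is 0. *)
Definition min_degree (G : sgraph) : nat := \big[minn/#|G|]_(x : G) degree x.

Definition edges (G : sgraph) : {set {set G}} :=
  [set [set p.1; p.2] | p : G * G & adj p.1 p.2].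

Definition induced_subgraph (G : sgraph) (S : {set G}) : sgraph.
Proof.
refine (@SGraph {x : G | x \in S} (fun x y => adj (val x) (val y)) _ _).
- by move=> x y; apply: adj_sym.
- by move=> x; apply: adj_irr.
Defined.

Definition spanning_subgraph (G : sgraph) (F : {set {set G}}) : sgraph.
Proof.
refine (@SGraph G (fun x y => adj x y && ([set x; y] \in F)) _ _).
- by move=> x y; rewrite adj_sym setUC.
- by move=> x; rewrite adj_irr.
Defined.

(* The probability that G_p satisfies A: the outcome is the set F of retained
   edges, under the product of Bernoulli(p) laws over the edges of G. *)
Definition prob_Gp (R : realFieldType) (p : R) (G : sgraph) (A : pred sgraph)
    : R :=
  \sum_(F : {set {set G}} | (F \subset edges G) && A (spanning_subgraph F))
    \prod_(e in edges G) (if e \in F then p else 1 - p).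

Lemma prob_GpT (R : realFieldType) (p : R) (G : sgraph) :
  prob_Gp p G predT = 1.
Proof.
have -> : 1 = \prod_(e : {set G}) ((if e \in edges G then p else 0) +
                                (if e \in edges G then 1 - p else 1)) :> R.
  by rewrite big1 // => e _; case: ifP => _; rewrite ?add0r // addrC subrK.
rewrite bigA_distr /prob_Gp /= [RHS](bigID (fun F : {set {set G}} => F \subset edges G)) /=.
rewrite [X in _ = _ + X]big1 ?addr0 => [|F /subsetPn[e eF eG]]; last first.
  by rewrite (bigD1 e) //= eF (negPf eG) mul0r.
apply: eq_big => [F|F /andP[FG _]]; first by rewrite andbT.
rewrite [LHS]big_mkcond; apply: eq_bigr => e _.
have [eF|_] := boolP (e \in F); last by case: ifP.
by rewrite (subsetP FG _ eF).
Qed.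

Lemma leq_min_degree (G : sgraph) (d : nat) (x0 : G) :
  (d <= min_degree G)%N = [forall x : G, d <= degree x]%N.
Proof.
apply/idP/forallP => [le_d x|le_d]; last first.
  rewrite /min_degree; apply: (big_ind (fun m => d <= m)%N) => //.
  - exact: leq_trans (le_d x0) (max_card _).
  - by move=> m n dm dn; rewrite leq_min dm.
apply: leq_trans le_d _; rewrite /min_degree.
elim: (index_enum _) (mem_index_enum x) => // y s IHs.
rewrite inE big_cons => /predU1P[->|/IHs]; first exact: geq_minl.
by apply: leq_trans; apply: geq_minr.
Qed.

(* Main.v *)
Require Import Defs.
From HB Require Import structures.
From mathcomp Require Import all_boot all_order all_algebra.
From mathcomp Require Import all_classical all_reals all_analysis.
From mathcomp Require Import zify ring lra.

(** Write k = 2rt. The graph is a blow-up: each vertex of a (2r)-regular base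
graph becomes a block of t independent vertices, and each base edge a complete
bipartite graph between two blocks. The base graph is a union of copies of the
cyclic group Z_Q in which x is joined to x + W + a and x - W - a for
0 <= a < r. Since (x, y) |-> xW + y winds the plane around Z_Q like a helix,
it looks locally like Z^2 with the steps (1, a) and (-1, -a).

For an outcome F of the random graph, the core is the union of all vertex sets
whose induced subgraph has minimum degree at least k/4 + alpha k; it contains
every subgraph H in question. A block is alive if it holds more than about
alpha t / 4 core vertices. Edge counts concentrate, so that with r + 1 or fewer
alive neighbouring blocks, slightly more than half of the 2r, a vertex keeps
about k/4 neighbours that could be in the core, fewer than required. Hence such
a block is dead unless it is bad, that is, unless many of its vertices have
exceptionally many F-neighbours in few blocks ([alive_rule]). This involves
order t vertices with an excess of order k each, so a block is bad with
probability exp(-c k^2) ([bad_bound]). A core vertex forces a neighbouring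
block to be alive ([core_near_alive]), so it is enough to kill almost all
blocks.

Death spreads. A point just outside a large disc of Z^2 has at most r + 1
neighbours outside the disc: of u + s and u - s at least one lies inside unless
s is nearly orthogonal to u, and at most one of the steps (1, a) is
([disc_grows]). So a dead disc (of radius depending on r only) can be
moved by unit steps wherever no bad block is near. Along the helix, an interval
of length L = W^2 with few bad points contains W consecutive good centres and,
together with the next interval, a good residue class modulo W, along which the
disc travels to the next interval; so death reaches all intervals
([infection_spreads]).

Probabilities are balanced as follows. A seed is a dead disc whose edges are all
missing; it involves n = O(k^2) edges and has probability 2^-n. An
interval is an obstacle only if it has at least h bad blocks, which has
probability about exp(-c h k^2). Because the seed does not depend on h, for h
large both are compatible with m = n 2^n intervals: some seed occurs, no
interval is an obstacle, and no bad block is near a seed, all up to probability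
exp(-c' k^2) ([failure_small]). After that a block can survive only near a bad
block, again with probability exp(-c' k^2) ([expect_core]). So the expected
fraction of vertices in the core is at most C (1 - beta)^(2 k^2), and Markov's
inequality splits this bound evenly between the size of the core and the
exceptional probability eps(k) = (1 - beta)^(k^2) ([prob_small_core]). The
number of copies of Z_Q makes the graph as large as desired, without changing
the expected fraction. *)

Set Implicit Arguments.
Unset Strict Implicit.
Unset Printing Implicit Defensive.

Import Order.TTheory GRing.Theory Num.Theory.
Import numFieldNormedType.Exports.
Local Open Scope ring_scope.

(** * Growth of dead discs in the plane *)
Lemma card_signed_le (r : nat) (P : pred ('I_r * bool)) :
  (forall a b : 'I_r, P (a, true) && P (a, false) ->
     P (b, true) && P (b, false) -> a = b) ->
  (#|P| <= r.+1)%N.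
Proof.
move=> uniqP.
have -> : #|P| = (\sum_(a < r) (P (a, true) + P (a, false)))%N.
  rewrite -sum1_card big_mkcond /=.
  rewrite (eq_bigr (fun p => if P (p.1, p.2) then 1 else 0)%N); last by case.
  rewrite -(pair_bigA _ (fun a b => if P (a, b) then 1 else 0)%N) /=.
  apply: eq_bigr => a _; rewrite big_bool /=.
  by case: (P (a, true)); case: (P (a, false)).
apply: (@leq_trans (\sum_(a < r) (1 + (P (a, true) && P (a, false))))).
  by apply: leq_sum => a _; case: (P (a, true)); case: (P (a, false)).
rewrite big_split /= sum1_card card_ord -addn1 leq_add2l.
rewrite -big_mkcond sum1_card; apply/card_le1_eqP => a b aP bP.
exact: uniqP.
Qed.

(** Large enough for [far_from_lines]; the cube comes from solving for u and v
there. *)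
Definition seed_radius (r : nat) : nat := (4 * r ^ 3)%N.

(** If u is nearly orthogonal to the two directions (1, a) and (1, b), then it
is short: subtracting the two conditions bounds v by a multiple of r^2, and
then u by a multiple of r^3. *)
Lemma far_from_lines (r : nat) (u v : int) (a b : nat) :
  (a < b < r)%N -> `|u + a%:Z * v| < (r ^ 2)%N%:Z ->
  `|u + b%:Z * v| < (r ^ 2)%N%:Z -> u * u + v * v <= (seed_radius r ^ 2)%N%:Z.
Proof.
rewrite /seed_radius => abr ha hb.
have r0 : (0 < r)%N by lia.
set s : int := r%:Z.
have es : (r ^ 2)%N%:Z = s * s by rewrite -mulnn PoszM.
have hv : `|v| <= 2 * (s * s).
  have : `|(b%:Z - a%:Z) * v| < 2 * (s * s) by rewrite es in ha hb; lia.
  rewrite normrM; set d := `|_ - _|; have : 1 <= d by lia.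
  by move=> d1; have := normr_ge0 v; nia.
have hu : `|u| <= s * s + s * (2 * (s * s)).
  have h1 : `|a%:Z * v| <= s * (2 * (s * s)).
    by rewrite normrM; apply: ler_pM => //; lia.
  by rewrite es in ha; lia.
have s1 : 1 <= s by lia.
have hu' : `|u| <= 3 * (s * s * s) by nia.
have hv' : `|v| <= 2 * (s * s * s) by nia.
have -> : ((4 * r ^ 3) ^ 2)%N%:Z = (4 * (s * s * s)) * (4 * (s * s * s)).
  have e3 : (r ^ 3)%N%:Z = s * s * s by rewrite !expnS expn0 muln1 !PoszM mulrA.
  by rewrite -mulnn (PoszM (4 * r ^ 3)%N) (PoszM 4) e3.
set q := s * s * s in hu' hv' *.
have q0 : 0 <= q by rewrite !mulr_ge0.
have : u * u = `|u| * `|u| by lia.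
have : v * v = `|v| * `|v| by lia.
have := normr_ge0 u; have := normr_ge0 v.
by move: `|u| `|v| hu' hv' => x y; nia.
Qed.

(** The width of one turn of the helix. A bad point spoils at most
(2 * seed_radius + 3)^2 centres, so h of them spoil at most W. *)
Definition pitch (r h : nat) := (h * (2 * seed_radius r + 3) ^ 2)%N.

Definition offset (r w : nat) (d : 'I_r * bool) : int :=
  if d.2 then (w + d.1)%N%:Z else - (w + d.1)%N%:Z.

(** In this section the helix is unrolled: a point (u, v) of the plane around
a centre c is the integer c + uW + v. *)
Section Growth.
Variables (r h : nat) (alive bad : int -> bool).
Hypothesis r_gt0 : (0 < r)%N.
Hypothesis h_gt0 : (0 < h)%N.

Local Notation W := (pitch r h).
Local Notation L := (W ^ 2)%N.

Hypothesis rule : forall x, ~~ bad x ->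
  (#|[pred d : 'I_r * bool | alive (x + offset W d)]| <= r.+1)%N -> ~~ alive x.

Definition dead_disc (c : int) (n : nat) :=
  forall u v : int, u * u + v * v <= n%:Z -> ~~ alive (c + u * W%:Z + v).

(** Discs of radius one more than that of the seeds, so that a dead disc with a
clean centre contains its translates by unit steps after it has grown. *)
Definition clean (c : int) := forall u v : int,
  u * u + v * v <= ((seed_radius r).+1 ^ 2)%N%:Z -> ~~ bad (c + u * W%:Z + v).

(** For a point (u, v) with squared norm n + 1, the neighbours (u+1, v+a) and
(u-1, v-a) both miss the disc only if |u + av| < r^2, which happens for at most
one a by [far_from_lines]. So at most r + 1 of the 2r neighbours are alive. *)
Lemma disc_grows c n : (seed_radius r ^ 2 <= n < (seed_radius r).+1 ^ 2)%N -> clean c ->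
  dead_disc c n -> dead_disc c n.+1.
Proof.
move=> /andP[Rn nR] fc dc u v uvn.
have [le_n|gt_n] := boolP (u * u + v * v <= n%:Z); first exact: dc.
have {gt_n} uvE : u * u + v * v = n%:Z + 1 by move: uvn gt_n; clear; lia.
apply: rule.
  by apply: fc; rewrite uvE; move: nR; clear; set q := (_ ^ 2)%N; lia.
apply: card_signed_le => a b.
have near (c' : 'I_r) : alive (c + u * W%:Z + v + offset W (c', true)) &&
    alive (c + u * W%:Z + v + offset W (c', false)) ->
    `|u + c'%:Z * v| < (r ^ 2)%N%:Z.
  move=> /andP[alive1 alive2]; rewrite ltNge; apply/negP => far.
  have short : (c' : nat)%:Z * c'%:Z + 2 <= 2 * (r ^ 2)%N%:Z.
    by have := ltn_ord c'; clear; rewrite -mulnn; nia.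
  have [pos|neg] := lerP 0 (u + c'%:Z * v).
    rewrite ger0_norm // in far.
    have := dc (u - 1) (v - c'%:Z).
    have -> : c + (u - 1) * W%:Z + (v - c'%:Z) =
              c + u * W%:Z + v + offset W (c', false).
      by rewrite /offset /= PoszD mulrBl mul1r; clear; lia.
    rewrite alive2 /= => H.
    suff /H : (u - 1) * (u - 1) + (v - c'%:Z) * (v - c'%:Z) <= n%:Z by [].
    move: short far uvE; clear; set q := (r ^ 2)%N%:Z; nia.
  rewrite ltr0_norm // in far.
  have := dc (u + 1) (v + c'%:Z).
  have -> : c + (u + 1) * W%:Z + (v + c'%:Z) =
            c + u * W%:Z + v + offset W (c', true).
    by rewrite /offset /= PoszD mulrDl mul1r; clear; lia.
  rewrite alive1 /= => H.
  suff /H : (u + 1) * (u + 1) + (v + c'%:Z) * (v + c'%:Z) <= n%:Z by [].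
  move: short far uvE; clear; set q := (r ^ 2)%N%:Z; nia.
move=> /near ha /near hb; apply: val_inj => /=.
have escape : (u * u + v * v <= (seed_radius r ^ 2)%N%:Z) -> False.
  by rewrite uvE; move: Rn; clear; set q := (seed_radius r ^ 2)%N; lia.
case: (ltngtP a b) => // lt; case: escape.
  by apply: (@far_from_lines r u v a b) => //; rewrite lt ltn_ord.
by apply: (@far_from_lines r u v b a) => //; rewrite lt ltn_ord.
Qed.

Lemma disc_fills c : clean c -> dead_disc c (seed_radius r ^ 2) ->
  dead_disc c ((seed_radius r).+1 ^ 2).
Proof.
move=> fc dc.
suff H : forall n, (seed_radius r ^ 2 + n <= (seed_radius r).+1 ^ 2)%N ->
    dead_disc c (seed_radius r ^ 2 + n).
  have le : (seed_radius r ^ 2 <= (seed_radius r).+1 ^ 2)%N by rewrite leq_exp2r.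
  by have := H ((seed_radius r).+1 ^ 2 - seed_radius r ^ 2)%N; rewrite subnKC //; apply.
elim=> [|n IHn] le; first by rewrite addn0.
rewrite addnS; apply: disc_grows => //; first by lia.
by apply: IHn; lia.
Qed.

(** The translate of the disc by a unit step lies in the disc of radius one
more, which dies first. *)
Lemma disc_shift c p s : clean c -> dead_disc c (seed_radius r ^ 2) ->
  (p * p + s * s = 1) -> dead_disc (c + p * W%:Z + s) (seed_radius r ^ 2).
Proof.
move=> fc dc ps u v uv.
have := disc_fills fc dc (u := u + p) (v := v + s).
have -> : c + (u + p) * W%:Z + (v + s) = c + p * W%:Z + s + u * W%:Z + v by lia.
apply.
set R := seed_radius r in uv *.
have eR : (R ^ 2)%N%:Z = R%:Z * R%:Z by rewrite -mulnn PoszM.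
have -> : (R.+1 ^ 2)%N%:Z = R%:Z * R%:Z + 2 * R%:Z + 1 by rewrite -mulnn; lia.
rewrite eR in uv.
have R0 : 0 <= R%:Z by [].
have hu : `|u| <= R%:Z by nia.
have hv : `|v| <= R%:Z by nia.
have : (p = 0 /\ (s = 1 \/ s = -1)) \/ (s = 0 /\ (p = 1 \/ p = -1)).
  have : -1 <= p <= 1 by nia.
  have : -1 <= s <= 1 by nia.
  by nia.
by case=> [[-> [->|->]]|[-> [->|->]]]; nia.
Qed.

Lemma disc_walk (p s x : int) (n : nat) : p * p + s * s = 1 ->
  (forall i : nat, (i < n)%N -> clean (x + i%:Z * (p * W%:Z + s))) ->
  dead_disc x (seed_radius r ^ 2) ->
  dead_disc (x + n%:Z * (p * W%:Z + s)) (seed_radius r ^ 2).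
Proof.
move=> ps; elim: n => [|n IHn] fx dx; first by rewrite mul0r addr0.
have -> : x + n.+1%:Z * (p * W%:Z + s) =
          x + n%:Z * (p * W%:Z + s) + p * W%:Z + s by rewrite intS; clear; lia.
apply: disc_shift => //; first exact: fx.
by apply: IHn => // i lti; apply: fx; lia.
Qed.

Lemma walk_interval (lo hi x y : int) : (forall c, lo <= c <= hi -> clean c) ->
  lo <= x <= hi -> lo <= y <= hi -> dead_disc x (seed_radius r ^ 2) ->
  dead_disc y (seed_radius r ^ 2).
Proof.
move=> fr xI yI dx; have [le_xy|lt_yx] := lerP x y.
  have -> : y = x + `|y - x|%N%:Z * (0 * W%:Z + 1) by move: le_xy; clear; lia.
  by apply: disc_walk => // i lti; apply: fr; rewrite mul0r add0r mulr1; lia.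
have -> : y = x + `|y - x|%N%:Z * (0 * W%:Z + (-1)) by move: lt_yx; clear; lia.
by apply: disc_walk => // i lti; apply: fr; rewrite mul0r add0r mulrN1; lia.
Qed.

Lemma reach_le (u v : int) : u * u + v * v <= ((seed_radius r).+1 ^ 2)%N%:Z ->
  [/\ `|u| <= (seed_radius r).+1%:Z, `|v| <= (seed_radius r).+1%:Z &
      `|u * W%:Z + v| <= L%:Z].
Proof.
rewrite -mulnn PoszM => uv.
have hu : `|u| <= (seed_radius r).+1%:Z by nia.
have hv : `|v| <= (seed_radius r).+1%:Z by nia.
split=> //.
have W_ge : ((2 * seed_radius r + 3) ^ 2 <= W)%N by rewrite leq_pmull.
apply: le_trans (ler_normD _ _) _; rewrite normrM.
have : ((seed_radius r).+1 * W.+1 <= W * W)%N.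
  move: W_ge; clear; rewrite -mulnn; set w := W; set q := seed_radius r; nia.
by rewrite -mulnn; move: hu hv; clear; set w := W; set q := (seed_radius r).+1; nia.
Qed.

Lemma clean_near (lo hi : int) :
  (forall c, lo - L%:Z <= c <= hi + L%:Z -> ~~ bad c) ->
  forall c, lo <= c <= hi -> clean c.
Proof.
move=> nb c cI u v /reach_le[_ _ uv]; apply: nb.
by rewrite -addrA; move: cI uv; clear; set q := u * _ + v; lia.
Qed.

(** Pigeonhole: fewer than h bad points spoil fewer than W centres, so some
colour of any colouring with W colours has no spoiled centre in the window. The
colour will be the block of W consecutive centres, or the residue modulo W. *)
Lemma clean_colour (col : int -> 'I_W) (lo : int) (len : nat) (p q : int) :
  (#|[set i : 'I_len | bad (lo + (i : nat)%:Z)]| < h)%N ->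
  lo + L%:Z <= p -> q + L%:Z <= lo + len%:Z ->
  exists i, forall c, p <= c < q -> col c = i -> clean c.
Proof.
set B := [set i | _] => few pL qL; pose K := (2 * seed_radius r + 3)%N.
pose ctr (x : 'I_len * ('I_K * 'I_K)) : int :=
  lo + (x.1 : nat)%:Z - ((x.2.1 : nat)%:Z - (seed_radius r).+1%:Z) * W%:Z
     - ((x.2.2 : nat)%:Z - (seed_radius r).+1%:Z).
pose S := [set col (ctr x) | x in finset.setX B finset.setT].
have : (#|S| < #|'I_W|)%N.
  apply: leq_ltn_trans (leq_imset_card _ _) _.
  rewrite cardsX cardsT card_prod !card_ord /pitch mulnn ltn_pmul2r //.
  by rewrite expn_gt0 addn_gt0 orbT.
rewrite -cardsT => ltS.
have /subsetPn[i _ iS] : ~~ ([set: 'I_W] \subset S).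
  by apply: contraL ltS => /subset_leq_card; rewrite -leqNgt.
exists i => c cI ci u v uv; apply/negP => badc; case/negP: iS.
have [hu hv huv] := reach_le uv.
have uK : (absz (u + (seed_radius r).+1%:Z)%R < K)%N.
  by move: hu; rewrite /K; clear; set w := seed_radius r; lia.
have vK : (absz (v + (seed_radius r).+1%:Z)%R < K)%N.
  by move: hv; rewrite /K; clear; set w := seed_radius r; lia.
have cK : (absz (c + u * W%:Z + v - lo)%R < len)%N.
  rewrite -addrA; move: cI pL qL huv; clear.
  by set w := u * _ + v; set l := L; lia.
apply/imsetP; exists (Ordinal cK, (Ordinal uK, Ordinal vK)); last first.
  rewrite -ci; congr col; rewrite /ctr /=.
  rewrite !gez0_abs.
  - by clear; set w := (seed_radius r).+1%:Z; lia.
  - by move: hv; clear; set w := (seed_radius r).+1%:Z; lia.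
  - by move: hu; clear; set w := (seed_radius r).+1%:Z; lia.
  - rewrite -addrA; move: cI pL qL huv; clear.
    by set w := u * _ + v; set l := L; lia.
rewrite !inE andbT /=; move: badc; congr (bad _).
rewrite gez0_abs; first by clear; lia.
rewrite -addrA; move: cI pL qL huv; clear.
by set w := u * _ + v; set l := L; lia.
Qed.

(** Such a run of W centres in the window from jL to (j+1)L meets all residue
classes modulo W, so any clean class can be entered from it. *)
Definition dead_run (j : nat) := exists2 x : nat, (x + W <= L)%N &
  forall y : nat, (x <= y < x + W)%N ->
    clean ((j * L)%N%:Z + y%:Z) /\
    dead_disc ((j * L)%N%:Z + y%:Z) (seed_radius r ^ 2).

Definition few_bad (j : nat) :=
  (#|[set i : 'I_(6 * L).+1 |
       bad ((j * L)%N%:Z - (3 * L)%N%:Z + (i : nat)%:Z)]| < h)%N.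

(** A clean residue class leads from the run in window j into a clean block of
the next window, and unit steps then kill the rest of this block. *)
Lemma dead_run_next j : few_bad j -> dead_run j -> dead_run j.+1.
Proof.
move=> few [x xL runx].
have W0 : (0 < W)%N by rewrite muln_gt0 h_gt0 expn_gt0 addn_gt0 orbT.
have LW : L = (W * W)%N by rewrite -mulnn.
have boundl : (j * L)%N%:Z - (3 * L)%N%:Z + L%:Z <= (j * L)%N%:Z.
  by move: L; clear; lia.
have boundr : (j * L)%N%:Z + (2 * L)%N%:Z + L%:Z <=
    (j * L)%N%:Z - (3 * L)%N%:Z + (6 * L).+1%:Z by move: L; clear; lia.
(* W disjoint blocks of W centres fill the next window; one is not spoiled. *)
have [i1 clean1] := clean_colour
  (fun c => Ordinal (ltn_pmod (`|c - (j * L)%N%:Z|%N %/ W) W0)) few boundl boundr.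
(* W residue classes modulo W run through both windows; one is not spoiled. *)
have [i2 clean2] := clean_colour
  (fun c => Ordinal (ltn_pmod `|c - (j * L)%N%:Z|%N W0)) few boundl boundr.
have {}clean1 (y : nat) : (i1 * W <= y < i1 * W + W)%N ->
    clean ((j.+1 * L)%N%:Z + y%:Z).
  move=> yI; have yL : (y < L)%N by have := ltn_ord i1; rewrite LW; nia.
  apply: clean1; first by move: yL; move: L; clear; lia.
  apply: val_inj => /=.
  have -> : absz ((j.+1 * L)%N%:Z + y%:Z - (j * L)%N%:Z)%R = (W * W + y)%N.
    by rewrite -LW; clear; move: L; lia.
  rewrite divnMDl // (_ : (y %/ W)%N = i1) ?modnDl ?modn_small //.
  by apply/eqP; rewrite eqn_leq -ltnS ltn_divLR // leq_divRL // mulSn addnC; lia.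
have {}clean2 (a : nat) : (a < 2 * W)%N -> clean ((j * L)%N%:Z + (i2 + a * W)%N%:Z).
  move=> aW; have yL : (i2 + a * W < 2 * L)%N by have := ltn_ord i2; rewrite LW; nia.
  apply: clean2; first by move: yL; set y := (_ + _)%N; move: L; clear; lia.
  apply: val_inj => /=.
  rewrite [X in absz X](_ : _ = (i2 + a * W)%N%:Z) ?absz_nat; last by clear; move: L; lia.
  by rewrite addnC modnMDl modn_small.
pose a := ((x + (W.-1 - i2)) %/ W)%N.
have i2W := ltn_ord i2.
have aI : (x <= i2 + a * W < x + W)%N.
  have := divn_eq (x + (W.-1 - i2)) W; have := ltn_pmod (x + (W.-1 - i2)) W0.
  by rewrite -/a; move: i2W; clear; lia.
have [_ dead2] := runx _ aI.
have aW : (a < W)%N by move: aI xL; rewrite LW; clear; nia.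
have dead1 : dead_disc ((j.+1 * L)%N%:Z + (i1 * W + i2)%N%:Z) (seed_radius r ^ 2).
  have -> : (j.+1 * L)%N%:Z + (i1 * W + i2)%N%:Z = (j * L)%N%:Z +
      (i2 + a * W)%N%:Z + (W + i1 - a)%N%:Z * (1 * W%:Z + 0).
    have e : ((W + i1 - a) * W + a * W = W * W + i1 * W)%N.
      by rewrite -mulnDl subnK ?mulnDl //; lia.
    rewrite mul1r addr0 -PoszM mulSn LW; move: e; clear.
    by move: (W * W)%N ((W + i1 - a) * W)%N (a * W)%N (i1 * W)%N (j * _)%N; lia.
  apply: disc_walk => // i lti.
  have -> : (j * L)%N%:Z + (i2 + a * W)%N%:Z + i%:Z * (1 * W%:Z + 0) =
     (j * L)%N%:Z + (i2 + (a + i) * W)%N%:Z by clear; lia.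
  by apply: clean2; have := ltn_ord i1; move: lti aW; clear; lia.
exists (i1 * W)%N.
  by have := ltn_ord i1; rewrite LW; clear; move: (i1 : nat) => i; set w := W; nia.
move=> y yI; split; first exact: clean1.
apply: (@walk_interval ((j.+1 * L)%N%:Z + (i1 * W)%N%:Z)
  ((j.+1 * L)%N%:Z + (i1 * W + W.-1)%N%:Z)
  ((j.+1 * L)%N%:Z + (i1 * W + i2)%N%:Z)) => //.
- move=> c cI.
  have -> : c = (j.+1 * L)%N%:Z + `|c - (j.+1 * L)%N%:Z|%N%:Z.
    by move: cI; clear; lia.
  by apply: clean1; move: cI W0; clear; lia.
- by move: i2W; clear; lia.
- by move: yI W0; clear; lia.
Qed.

(** From a seed in window j0, dead runs pass to all later windows; a point
without bad points around it is joined to the run of its window by unit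
steps. *)
Lemma infection_spreads (j0 : nat) :
  (forall j, (j0 <= j)%N -> few_bad j) ->
  (forall c, `|c - (j0 * L)%N%:Z| <= (3 * L)%N%:Z -> ~~ bad c) ->
  dead_disc (j0 * L)%N%:Z (seed_radius r ^ 2) ->
  forall z : int, (j0 * L)%N%:Z <= z ->
  (forall c, `|c - z| <= (3 * L)%N%:Z -> ~~ bad c) -> ~~ alive z.
Proof.
move=> few nbad0 dead0 z zj nbadz.
have W0 : (0 < W)%N by rewrite muln_gt0 h_gt0 expn_gt0 addn_gt0 orbT.
have WL : (W <= L)%N by rewrite leq_pmull.
have L0 : (0 < L)%N by rewrite expn_gt0 W0.
have run0 : dead_run j0.
  exists 0%N => // y yI.
  have fr : forall c, (j0 * L)%N%:Z <= c <= (j0 * L)%N%:Z + W%:Z -> clean c.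
    apply: clean_near => c cI; apply: nbad0.
    by move: cI WL; move: L; clear; lia.
  split; first by apply: fr; lia.
  apply: (walk_interval fr _ _ dead0); first by lia.
  by move: yI; clear; lia.
have {}run0 n : dead_run (j0 + n).
  by elim: n => [|n IHn]; rewrite ?addn0 // addnS; apply: dead_run_next => //; apply: few; lia.
have [n [zl zr]] : exists n, ((j0 + n) * L)%N%:Z <= z /\
    z < ((j0 + n) * L)%N%:Z + L%:Z.
  exists (`|z - (j0 * L)%N%:Z|%N %/ L)%N.
  have := divn_eq `|z - (j0 * L)%N%:Z|%N L; have := ltn_pmod `|z - (j0 * L)%N%:Z|%N L0.
  rewrite mulnDl; move: zj; clear.
  by set m := (_ * L)%N; set q := (_ * L)%N; set l := L; lia.
have [x xL runx] := run0 n.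
have [|_ dx] := runx x; first by lia.
have := @walk_interval (z - L%:Z) (z + L%:Z) _ z _ _ _ dx 0 0.
rewrite mul0r !addr0; apply.
- apply: clean_near => c cI; apply: nbadz.
  by move: cI; move: L; clear; lia.
- by move: zl zr xL W0; move: W L; clear; lia.
- by move: L; clear; lia.
- by [].
Qed.
End Growth.

(** * Uniform random edge sets *)
Lemma cosh_le_expR (R : realType) (y : R) : `|y| <= 1 / 2 ->
  (expR y + expR (- y)) / 2 <= expR (2 * y ^+ 2).
Proof.
rewrite ler_norml => /andP[yl yr].
have inv_le (z : R) : z < 1 -> expR z <= (1 - z)^-1.
  move=> z1; rewrite -[expR z]invrK -expRN lef_pV2 ?posrE ?expR_gt0 ?subr_gt0 //.
  exact: expR_ge1Dx.
apply: le_trans (expR_ge1Dx _).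
have e1 : expR y <= (1 - y)^-1 by apply: inv_le; lra.
have e2 : expR (- y) <= (1 + y)^-1.
  by rewrite -[y in (1 + y)]opprK; apply: inv_le; lra.
apply: (@le_trans _ _ (((1 - y)^-1 + (1 + y)^-1) / 2)); first by lra.
have -> : ((1 - y)^-1 + (1 + y)^-1) / 2 = (1 - y ^+ 2)^-1.
  by field; rewrite !lt0r_neq0 //; nra.
have y2 : y ^+ 2 <= 1 / 4 by nra.
have y0 := sqr_ge0 y.
rewrite -[X in X <= _]mulr1 ler_pdivrMl; last by lra.
by nra.
Qed.

Section Expectation.
Variables (R : realType) (G : sgraph).
Implicit Types (F Z : {set {set G}}) (f : {set {set G}} -> R).

Definition expect f : R := (\sum_(F in powerset (edges G)) f F) / 2 ^+ #|edges G|.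

Lemma prob_half (A : pred sgraph) :
  prob_Gp (1 / 2) G A = expect (fun F => (A (spanning_subgraph F))%:R).
Proof.
rewrite /prob_Gp /expect big_distrl /= big_mkcondr /=.
apply: eq_big => [F|F]; first by rewrite powersetE.
move=> _; case: ifP => _; last by rewrite mul0r.
rewrite (eq_bigr (fun=> 2^-1)) ?prodr_const ?exprVn ?mul1r // => e _.
by case: ifP => _; lra.
Qed.

Lemma expect_le f1 f2 : (forall F, F \subset edges G -> f1 F <= f2 F) ->
  expect f1 <= expect f2.
Proof.
move=> le12; rewrite /expect ler_pM2r ?invr_gt0 ?exprn_gt0 //.
by apply: ler_sum => F; rewrite powersetE; apply: le12.
Qed.

Lemma expect_sum (I : finType) (P : pred I) (f : I -> {set {set G}} -> R) :
  expect (fun F => \sum_(i | P i) f i F) = \sum_(i | P i) expect (f i).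
Proof.
by rewrite /expect exchange_big /= big_distrl.
Qed.

Lemma expectZ a f : expect (fun F => a * f F) = a * expect f.
Proof. by rewrite /expect -big_distrr /= mulrA. Qed.

Lemma expectD f1 f2 : expect (fun F => f1 F + f2 F) = expect f1 + expect f2.
Proof. by rewrite /expect big_split /= mulrDl. Qed.

Lemma expect_prod (w : {set G} -> bool -> R) :
  expect (fun F => \prod_(e in edges G) w e (e \in F)) =
  \prod_(e in edges G) ((w e true + w e false) / 2).
Proof.
rewrite big_split /= prodr_const exprVn /expect; congr (_ / _).
rewrite [RHS]big_mkcond /=.
have -> : \prod_e (if e \in edges G then w e true + w e false else 1) =
  \prod_e ((if e \in edges G then w e true else 0) +
           (if e \in edges G then w e false else 1)).
  by apply: eq_bigr => e _; case: ifP; rewrite ?add0r.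
rewrite bigA_distr /= [RHS](bigID (fun F : {set {set G}} => F \subset edges G)) /=.
rewrite [X in _ = _ + X]big1 ?addr0 => [|F /subsetPn[e eF eG]]; last first.
  by rewrite (bigD1 e) //= eF (negPf eG) mul0r.
apply: eq_big => [F|F]; first by rewrite powersetE.
rewrite powersetE => FG; rewrite [LHS]big_mkcond; apply: eq_bigr => e _.
have [eF|_] := boolP (e \in F); last by case: ifP.
by rewrite (fintype.subsetP FG _ eF).
Qed.

Lemma disjoint_prod F Z : Z \subset edges G ->
  [disjoint F & Z]%:R =
  \prod_(e in edges G) (if e \in Z then (~~ (e \in F))%:R else 1) :> R.
Proof.
move=> ZE; have [FZ|] := boolP [disjoint F & Z].
  rewrite big1 // => e _; case: ifP => // eZ.
  by rewrite (disjointFl FZ eZ).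
rewrite -setI_eq0 => /set0Pn[e]; rewrite inE => /andP[eF eZ].
by rewrite (bigD1 e) ?(fintype.subsetP ZE) //= eZ eF mul0r.
Qed.

Lemma prod_if_card Z (c : R) : Z \subset edges G ->
  \prod_(e in edges G) (if e \in Z then c else 1) = c ^+ #|Z|.
Proof.
move=> ZE; rewrite -big_mkcondr -prodr_const; apply: eq_bigl => e.
by rewrite andb_idl // => /(fintype.subsetP ZE).
Qed.

Lemma expect_disjoint Z : Z \subset edges G ->
  expect (fun F => [disjoint F & Z]%:R) = 2 ^- #|Z|.
Proof.
move=> ZE; rewrite /expect; under eq_bigr do rewrite disjoint_prod //.
rewrite -/(expect _) (expect_prod (fun e b => if e \in Z then (~~ b)%:R else 1)) /=.
rewrite -exprVn -prod_if_card //; apply: eq_bigr => e _.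
by case: ifP => _; [rewrite add0r mul1r | lra].
Qed.

(** Inclusion-exclusion: the product over j of 1 - 1[F misses Z j] expands into
events of missing unions, whose probabilities are powers of 2^-n. *)
Lemma expect_all_met (J : finType) (Z : J -> {set {set G}}) (n : nat) :
  (forall j, Z j \subset edges G) -> (forall j, #|Z j| = n) ->
  (forall i j, i != j -> [disjoint Z i & Z j]) ->
  expect (fun F => [forall j, ~~ [disjoint F & Z j]]%:R) = (1 - 2 ^- n) ^+ #|J|.
Proof.
move=> ZE Zn Zdisj.
have expand (a : J -> R) : \prod_j (1 - a j) =
    \sum_(D : {set J}) (-1) ^+ #|D| * \prod_(j in D) a j.
  under eq_bigr do rewrite addrC.
  rewrite bigA_distr /=; apply: eq_bigr => D _.
  rewrite -prodrN [RHS]big_mkcond /=; apply: eq_bigr => j _.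
  by case: ifP.
have -> : (1 - 2 ^- n) ^+ #|J| = \prod_(j : J) (1 - 2 ^- n) :> R.
  by rewrite prodr_const.
rewrite expand.
transitivity (expect (fun F => \sum_(D : {set J}) (-1) ^+ #|D| *
    [disjoint F & \bigcup_(j in D) Z j]%:R)).
  rewrite /expect; congr (_ / _); apply: eq_bigr => F _.
  transitivity (\prod_j (1 - [disjoint F & Z j]%:R) : R).
    have [/forallP met|] := boolP [forall j, ~~ [disjoint F & Z j]].
      by rewrite big1 // => j _; rewrite (negPf (met j)) subr0.
    rewrite negb_forall => /existsP[j]; rewrite negbK => FZ.
    by rewrite (bigD1 j) //= FZ subrr mul0r.
  rewrite expand; apply: eq_bigr => D _; congr (_ * _).
  have [FD|] := boolP [disjoint F & \bigcup_(j in D) Z j].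
    rewrite big1 // => j jD; suff -> : [disjoint F & Z j] by [].
    by apply: disjointWr FD; apply: finset.bigcup_sup.
  rewrite -setI_eq0 => /set0Pn[e]; rewrite inE => /andP[eF /finset.bigcupP[j jD eZ]].
  rewrite (bigD1 j) //= (_ : [disjoint F & Z j] = false) ?mul0r //.
  by apply/negbTE; rewrite -setI_eq0; apply/set0Pn; exists e; rewrite inE eF.
rewrite expect_sum; apply: eq_bigr => D _; rewrite expectZ; congr (_ * _).
rewrite expect_disjoint; last by apply/finset.bigcupsP => j _.
rewrite prodr_const -!exprVn -exprM; congr (_ ^+ _).
have -> : \bigcup_(j in D) Z j = \bigcup_j (if j \in D then Z j else finset.set0).
  exact: big_mkcond.
rewrite -sum1_card partition_disjoint_bigcup => [|i j ij]; last first.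
  by case: ifP => _; case: ifP => _; rewrite ?Zdisj // -setI_eq0 ?finset.set0I ?finset.setI0.
rewrite mulnC -sum_nat_const [RHS]big_mkcond /=; apply: eq_bigr => j _.
by case: ifP => _; rewrite sum1_card ?Zn ?cards0.
Qed.

Definition edge_of (p : G * G) : {set G} := [set p.1; p.2].

Lemma card_edge_of_fiber (S : {set G * G}) e :
  (#|[set p in S | edge_of p == e]| <= 2)%N.
Proof.
have [->|[p]] := set_0Vmem [set p in S | edge_of p == e]; first by rewrite cards0.
rewrite inE => /andP[_ /eqP <-].
apply: leq_trans (_ : #|[set p; (p.2, p.1)]| <= 2)%N; last first.
  by rewrite cards2; case: (_ != _).
apply/subset_leq_card/fintype.subsetP => -[x y]; rewrite !inE => /andP[_ /eqP].
case: p => a b; rewrite /edge_of /= => E; rewrite !xpair_eqE.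
have : x \in [set a; b] by rewrite -E set21.
have : y \in [set a; b] by rewrite -E set22.
have : a \in [set x; y] by rewrite E set21.
have : b \in [set x; y] by rewrite E set22.
by rewrite !inE => /orP[]/eqP h1 /orP[]/eqP h2 /orP[]/eqP h3 /orP[]/eqP h4;
  subst; rewrite ?eqxx ?orbT.
Qed.

Lemma edge_ofE p : adj p.1 p.2 -> edge_of p \in edges G.
Proof. by move=> ap; rewrite /edges; apply/imsetP; exists p; rewrite // inE. Qed.

(** Exponential Markov inequality, for arcs rather than edges since two bad
blocks may count the same edge from both ends: an edge has multiplicity at
most 2, which only changes the constant in the exponent. Edges of Z are absent
and only lower the sum, so the event that Z is missed contributes a separate
factor. *)
Lemma deviation_bound Z (S : {set G * G}) (theta lam : R) :
  Z \subset edges G -> (forall p, p \in S -> adj p.1 p.2) ->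
  0 <= theta <= 1 / 2 ->
  expect (fun F => ([disjoint F & Z] &&
      (lam <= \sum_(p in S) ((edge_of p \in F)%:R - 1 / 2)))%:R) <=
  2 ^- #|Z| * expR (theta ^+ 2 * #|S|%:R - theta * lam).
Proof.
move=> ZE Sadj /andP[th0 th1].
pose mult (e : {set G}) := #|[set p in S | edge_of p == e]|.
pose w (e : {set G}) (b : bool) : R :=
  (if e \in Z then (~~ b)%:R else 1) * expR (theta * (mult e)%:R * (b%:R - 1 / 2)).
have sum_mult (c : {set G} -> R) :
    \sum_(p in S) c (edge_of p) = \sum_(e in edges G) (mult e)%:R * c e.
  rewrite (partition_big edge_of (mem (edges G))) /=; last first.
    by move=> p /Sadj /edge_ofE.
  apply: eq_bigr => e _; rewrite (eq_bigr (fun=> c e)); last first.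
    by move=> p /andP[_ /eqP->].
  rewrite sumr_const mulr_natl; congr (_ *+ _).
  by apply: eq_card => p; rewrite inE.
apply: le_trans (_ : expect (fun F => expR (- (theta * lam)) *
    \prod_(e in edges G) w e (e \in F)) <= _).
  apply: expect_le => F FE.
  rewrite /w [X in _ <= _ * X]big_split /= -(disjoint_prod F ZE) -expR_sum.
  have -> : \sum_(e in edges G) theta * (mult e)%:R * ((e \in F)%:R - 1 / 2) =
      theta * \sum_(p in S) ((edge_of p \in F)%:R - 1 / 2) :> R.
    rewrite (sum_mult (fun e => (e \in F)%:R - 1 / 2)) big_distrr /=.
    by apply: eq_bigr => e _; rewrite mulrA.
  case: [disjoint F & Z]; last by rewrite /= mul0r mulr0.
  rewrite [_ * expR (theta * _)]mul1r -expRD; case: (lerP lam) => /= [le_lam|_]; last exact: expR_ge0.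
  apply: le_trans (expR_ge1Dx _); rewrite lerDl addrC -mulrBr.
  by apply: mulr_ge0; rewrite ?subr_ge0.
rewrite expectZ expect_prod mulrC expRD mulrA ler_pM2r ?expR_gt0 //.
rewrite -exprVn -prod_if_card //.
have -> : theta ^+ 2 * #|S|%:R = \sum_(e in edges G) theta ^+ 2 * (mult e)%:R.
  rewrite -sum1_card natr_sum (sum_mult (fun=> 1)) big_distrr /=.
  by apply: eq_bigr => e _; rewrite mulr1.
rewrite expR_sum -big_split /=; apply: ler_prod => e eE; apply/andP; split.
  apply: divr_ge0 => //; apply: addr_ge0; apply: mulr_ge0; rewrite ?expR_ge0 //.
    by case: ifP.
  by case: ifP.
rewrite /w; set m := mult e.
have m2 : (m%:R : R) <= 2 by rewrite ler_nat card_edge_of_fiber.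
have m0 : 0 <= (m%:R : R) by [].
have tm0 : 0 <= theta * m%:R by apply: mulr_ge0.
case: ifP => _ /=.
  rewrite mul0r add0r [_ * expR (theta * _ * _)]mul1r [leRHS]mulrC.
  rewrite ler_pM2r ?invr_gt0 // ler_expR.
  by have := sqr_ge0 theta; nra.
rewrite ![1 * expR _]mul1r.
have -> : theta * m%:R * (1 - 1 / 2) = theta * m%:R / 2 by lra.
have -> : theta * m%:R * (0 - 1 / 2) = - (theta * m%:R / 2) by lra.
apply: le_trans (cosh_le_expR _) _; first by rewrite ger0_norm; nra.
rewrite ler_expR.
have -> : 2 * (theta * m%:R / 2) ^+ 2 = theta ^+ 2 * (m%:R * m%:R / 2).
  by rewrite !expr2; lra.
by apply: ler_wpM2l; rewrite ?sqr_ge0 //; nra.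
Qed.
End Expectation.

(** * The core and the blow-up of a base graph *)
Section Core.
Variables (R : realType) (G : sgraph) (thr : R).
Implicit Types (F : {set {set G}}) (S : {set G}).

Definition nbrs_in F S (x : G) := [set y in S | adj x y && (edge_of (x, y) \in F)].

Definition sturdy F S := [forall x in S, thr <= #|nbrs_in F S x|%:R].

Definition core F := \bigcup_(S : {set G} | sturdy F S) S.

(** Sets of large minimum degree are closed under union. *)
Lemma core_degree F x : x \in core F -> thr <= #|nbrs_in F (core F) x|%:R.
Proof.
move=> /finset.bigcupP[S stS xS]; have /forall_inP/(_ _ xS) := stS.
move/le_trans; apply; rewrite ler_nat; apply/subset_leq_card/fintype.subsetP => y.
rewrite !inE => /andP[yS ->]; rewrite andbT.
by apply/finset.bigcupP; exists S.
Qed.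

Lemma min_degree_sub_core F (S : {set spanning_subgraph F}) :
  thr <= (min_degree (induced_subgraph S))%:R -> S \subset core F.
Proof.
move=> thrS; apply: finset.bigcup_sup; apply/forall_inP => x xS.
apply: le_trans thrS _; rewrite ler_nat.
pose x0 : induced_subgraph S := exist _ x xS.
have := leqnn (min_degree (induced_subgraph S)).
rewrite (leq_min_degree _ x0) => /forallP/(_ x0)/leq_trans; apply.
rewrite /degree -(card_imset _ val_inj); apply/subset_leq_card.
apply/fintype.subsetP => y /imsetP[z]; rewrite inE /= => zP ->.
by rewrite inE (valP z).
Qed.
End Core.

Definition reverse (r : nat) (d : 'I_r * bool) := (d.1, ~~ d.2).

Lemma card_set (T : finType) : #|{set T}| = (2 ^ #|T|)%N.
Proof.
rewrite -(cardsT T) -card_powerset; apply: eq_card => A.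
by rewrite powersetE finset.subsetT.
Qed.

Section Blowup.
Variables (B : finType) (r t : nat) (nb : 'I_r * bool -> B -> B).
Hypothesis nbK : forall d b, nb (reverse d) (nb d b) = b.
Hypothesis nb_neq : forall d b, nb d b != b.
Hypothesis nb_inj : forall b, injective (nb ^~ b).

Definition blowup : sgraph.
Proof.
refine (@SGraph (B * 'I_t)%type (fun x y => [exists d, y.1 == nb d x.1]) _ _).
- move=> x y; apply/existsP/existsP => -[d /eqP e]; exists (reverse d);
  by rewrite e nbK.
- by move=> x; apply/existsP => -[d]; rewrite eq_sym (negPf (nb_neq _ _)).
Defined.

Lemma blowup_regular : regular_graph (2 * r * t) blowup.
Proof.
move=> x; rewrite /degree.
have -> : [set y | adj x y] = finset.setX [set nb d x.1 | d : 'I_r * bool] [set: 'I_t].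
  apply/setP => -[c i]; rewrite !inE andbT /=.
  apply/existsP/imsetP => [[d /eqP->]|[d _ ->]]; first by exists d.
  by exists d.
rewrite cardsX (card_imset _ (@nb_inj x.1)) cardsT card_ord card_prod card_ord.
by rewrite card_bool (mulnC r).
Qed.

Definition reach (A : {set 'I_r * bool}) (b : B) : {set blowup} :=
  [set y : B * 'I_t | [exists d in A, y.1 == nb d b]].

Lemma card_reach A b : (#|reach A b| <= #|A| * t)%N.
Proof.
have -> : (#|A| * t)%N = #|finset.setX A [set: 'I_t]| by rewrite cardsX cardsT card_ord.
apply: leq_trans (leq_imset_card (fun x => (nb x.1 b, x.2)) _).
apply/subset_leq_card/fintype.subsetP => -[c i]; rewrite inE /=.
move=> /exists_inP[d dA /eqP->]; apply/imsetP; exists (d, i) => //.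
by rewrite !inE dA.
Qed.

Variables (R : realType) (alpha : R).
Hypothesis alpha_gt0 : 0 < alpha.
Hypothesis alpha_le1 : alpha <= 1.
Hypothesis r_large : 1 <= r%:R * alpha.
Hypothesis t_gt0 : (0 < t)%N.

Local Notation k := ((2 * r * t)%N%:R : R).
Definition threshold : R := k / 4 + alpha * k.
Local Notation thr := threshold.
(** With this share of core vertices left in dead blocks, they account for at
most a quarter of the excess alpha k of the threshold over k / 4. *)
Definition quorum : nat := (Num.truncn (alpha / 4 * t%:R)).+1.
Local Notation g := quorum.
Implicit Types (F : {set {set blowup}}) (b : B).

Lemma quorumP : g.-1%:R <= alpha / 4 * t%:R < g%:R.
Proof.
by apply: Num.Theory.truncn_itv; apply: mulr_ge0 => //; apply: divr_ge0 => //; apply: ltW.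
Qed.

Definition alive F b := (g <= #|[set i | ((b, i) : blowup) \in core thr F]|)%N.

(** The left-hand side is the least number of edges from g core vertices to the
blocks in the directions UA.2 when all other neighbouring blocks are dead, since
2r dead blocks hold at most alpha k / 4 core vertices. *)
Definition crowded F b (UA : {set 'I_t} * {set 'I_r * bool}) :=
  g%:R * (thr - alpha / 4 * k) <=
  \sum_(i in UA.1) \sum_(y in reach UA.2 b) (edge_of (((b, i) : blowup), y) \in F)%:R.

Definition admissible (UA : {set 'I_t} * {set 'I_r * bool}) :=
  (#|UA.1| == g) && (#|UA.2| <= r.+1)%N.

Definition bad F b := [exists UA, admissible UA && crowded F b UA].

(** The dead blocks outside the directions A hold at most alpha k / 4 core
vertices, so all other core neighbours are found in the directions A. *)
Lemma core_degree_split F b (i : 'I_t) (A : {set 'I_r * bool}) :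
  ((b, i) : blowup) \in core thr F -> (forall d, alive F (nb d b) -> d \in A) ->
  thr - alpha / 4 * k <= \sum_(y in reach A b) (edge_of (((b, i) : blowup), y) \in F)%:R.
Proof.
move=> bi aliveA; have thr_le := core_degree bi.
pose core_in d := [set y in core thr F | y.1 == nb d b].
have core_in_le d : d \notin A -> (#|core_in d| <= g.-1)%N.
  move=> dA; rewrite -ltnS prednK // ltnNge; apply: contra dA => le; apply: aliveA.
  apply: leq_trans le _; rewrite /alive.
  have inj : injective (fun j : 'I_t => ((nb d b, j) : blowup)) by move=> j1 j2 [].
  rewrite -[leqRHS](card_imset _ inj).
  apply/subset_leq_card/fintype.subsetP => -[c j]; rewrite inE /= => /andP[cj /eqP E].
  by apply/imsetP; exists j; rewrite ?inE -E.
have sub : nbrs_in F (core thr F) ((b, i) : blowup) \subset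
    [set y in reach A b | edge_of (((b, i) : blowup), y) \in F] :|:
    \bigcup_(d in ~: A) core_in d.
  apply/fintype.subsetP => y; rewrite !inE => /andP[yc /andP[/existsP[d yd] ->]].
  rewrite andbT; have [dA|dA] := boolP (d \in A).
    by apply/orP; left; apply/exists_inP; exists d.
  apply/orP; right; apply/finset.bigcupP; exists d; first by rewrite inE.
  by rewrite inE yc.
have card_bigcup : (#|\bigcup_(d in ~: A) core_in d| <= 2 * r * g.-1)%N.
  apply: (@leq_trans (\sum_(d in ~: A) #|core_in d|)).
    elim/big_ind2 : _ => [|m s n u le1 le2|//]; first by rewrite cards0.
    by apply: leq_trans (leq_card_setU _ _) _; apply: leq_add.
  apply: (@leq_trans (\sum_(d in ~: A) g.-1)).
    by apply: leq_sum => d; rewrite inE; apply: core_in_le.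
  rewrite sum_nat_const leq_mul2r; apply/orP; right.
  by apply: leq_trans (max_card _) _; rewrite card_prod card_ord card_bool mulnC.
have : thr <= #|[set y in reach A b | edge_of (((b, i) : blowup), y) \in F]|%:R +
    (2 * r * g.-1)%:R.
  apply: le_trans thr_le _; rewrite -natrD ler_nat.
  apply: leq_trans (subset_leq_card sub) _.
  by apply: leq_trans (leq_card_setU _ _) _; rewrite leq_add2l.
have -> : #|[set y in reach A b | edge_of (((b, i) : blowup), y) \in F]|%:R =
    \sum_(y in reach A b) (edge_of (((b, i) : blowup), y) \in F)%:R :> R.
  rewrite -sum1_card natr_sum [RHS](eq_bigr (fun y =>
     if edge_of (((b, i) : blowup), y) \in F then 1 else 0)); last by move=> y _; case: ifP.
  by rewrite -big_mkcondr; apply: eq_bigl => y; rewrite inE.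
have /andP[gle _] := quorumP; rewrite natrM.
have : (2 * r)%:R * g.-1%:R <= (2 * r)%:R * (alpha / 4 * t%:R) :> R by apply: ler_wpM2l.
by rewrite (natrM _ (2 * r) t); lra.
Qed.

Lemma alive_rule F b : ~~ bad F b ->
  (#|[pred d | alive F (nb d b)]| <= r.+1)%N -> ~~ alive F b.
Proof.
move=> nbad few; apply: contra nbad => al.
have [U UC cU] : exists2 U : {set 'I_t},
    U \subset [set i | ((b, i) : blowup) \in core thr F] & #|U| = g.
  move: al; rewrite /alive; set C := [set i | _] => gC.
  exists [set i in take g (enum C)].
    apply/fintype.subsetP => i; rewrite inE => /mem_take.
    by rewrite mem_enum.
  rewrite cardsE; have /card_uniqP -> : uniq (take g (enum C)).
    by rewrite take_uniq // enum_uniq.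
  by rewrite size_take -cardE; case: ltngtP gC.
apply/existsP; exists (U, [set d | alive F (nb d b)]).
rewrite /admissible /= cU eqxx /=; apply/andP; split.
  by rewrite cardsE.
rewrite /crowded /= -cU mulr_natl -sumr_const; apply: ler_sum => i iU.
apply: core_degree_split => [|d]; last by rewrite inE.
by have := fintype.subsetP UC _ iU; rewrite inE.
Qed.

Lemma core_near_alive F b (i : 'I_t) : ((b, i) : blowup) \in core thr F ->
  exists d, alive F (nb d b).
Proof.
move=> bi; apply/existsP; apply: contraT; rewrite negb_exists => /forallP dead.
have := @core_degree_split F b i finset.set0 bi.
rewrite big1 => [H|y]; last first.
  by rewrite inE => /exists_inP[d]; rewrite inE.
have /H : forall d, alive F (nb d b) -> d \in finset.set0.
  by move=> d; rewrite (negPf (dead d)).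
have r0 : (0 < r)%N by case: (r) r_large => //; rewrite mul0r ler10.
have : 0 < k by rewrite ltr0n !muln_gt0 r0 t_gt0.
by rewrite /threshold; have := alpha_gt0; nra.
Qed.

(** The first factor counts the choices of a pair UA, the second one is the
large deviation bound for a fixed pair. *)
Definition bad_rate : R := 2 ^+ (t + 2 * r) * expR (- (g%:R * t%:R * r%:R * alpha ^+ 2 / 8)).

Lemma bad_rate_ge0 : 0 <= bad_rate.
Proof. by rewrite mulr_ge0 ?exprn_ge0 ?expR_ge0. Qed.

(** Union bound over the choice of a pair UA for each block of Y, followed by
[deviation_bound] for all arcs counted by these pairs together. No independence
of the blocks is used, so Y may contain adjacent blocks. The expected number of
edges is at most g (r + 1) t / 2 per block, and the hypothesis 1 <= r alpha makes
the excess at least g t r alpha. *)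
Lemma bad_bound (Y : {set B}) (Z : {set {set blowup}}) : Z \subset edges blowup ->
  expect (fun F => ([disjoint F & Z] && [forall b in Y, bad F b])%:R) <=
  2 ^- #|Z| * bad_rate ^+ #|Y|.
Proof.
move=> ZE; rewrite /bad_rate; set rho := expR _.
pose J := ({set 'I_t} * {set 'I_r * bool})%type.
pose S (f : {ffun B -> J}) : {set blowup * blowup} :=
  [set p : blowup * blowup | (p.1.1 \in Y) && (p.1.2 \in (f p.1.1).1) &&
                             (p.2 \in reach (f p.1.1).2 p.1.1)].
have sumS (f : {ffun B -> J}) (c : blowup * blowup -> R) :
    \sum_(p in S f) c p = \sum_(b in Y) \sum_(i in (f b).1)
      \sum_(y in reach (f b).2 b) c ((b, i), y).
  rewrite pair_big_dep /= pair_big_dep /=.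
  apply: eq_big => [[[b i] y]|[[b i] y] _] //.
  by rewrite inE.
pose lam : R := #|Y|%:R * (g%:R * t%:R * r%:R * alpha).
pose j0 : J := (finset.set0, finset.set0).
pose D := pffun_on j0 (mem Y) admissible.
have g0 : 0 <= g%:R :> R by [].
have t0 : 0 < t%:R :> R by rewrite ltr0n.
have r0 : 0 < r%:R :> R.
  by rewrite ltr0n; case: (r) r_large => //; rewrite mul0r ler10.
have fadm f b : f \in D -> b \in Y -> admissible (f b).
  move=> fD bY; have /pffun_onP[_ fa] := fD.
  exact: (fa (f b) (fintype.image_f f bY)).
have reach_le f b : f \in D -> b \in Y ->
    #|reach (f b).2 b|%:R <= (r%:R + 1) * t%:R :> R.
  move=> fD bY; have /andP[_ fb] := fadm f b fD bY.
  rewrite natr1 -natrM ler_nat; apply: leq_trans (card_reach _ _) _.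
  by rewrite leq_mul2r fb orbT.
have cardU f b : f \in D -> b \in Y -> #|(f b).1| = g.
  by move=> fD bY; have /andP[/eqP] := fadm f b fD bY.
have term f : f \in D -> expect (fun F => ([disjoint F & Z] &&
    (lam <= \sum_(p in S f) ((edge_of p \in F)%:R - 1 / 2)))%:R) <=
    2 ^- #|Z| * rho ^+ #|Y|.
  (* With r + 1 <= 2r this theta minimizes the exponent. *)
  move=> fD; apply: le_trans (deviation_bound (theta := alpha / 4) lam ZE _ _) _.
  - move=> p; rewrite inE => /andP[_]; rewrite inE => /exists_inP[d _ /eqP pd].
    by apply/existsP; exists d; rewrite pd.
  - by have := alpha_gt0; have := alpha_le1; lra.
  apply: ler_wpM2l; first by rewrite invr_ge0 exprn_ge0.
  rewrite /rho -expRM_natl ler_expR.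
  have cardS : #|S f|%:R <= #|Y|%:R * (g%:R * ((r%:R + 1) * t%:R)) :> R.
    rewrite -sum1_card natr_sum (sumS f (fun=> 1)) mulr_natl -sumr_const.
    apply: ler_sum => b bY; rewrite -(cardU f b) // mulr_natl -sumr_const.
    by apply: ler_sum => i iU; rewrite sumr_const (reach_le f b).
  have a2 := sqr_ge0 (alpha / 4).
  apply: le_trans (_ : (alpha / 4) ^+ 2 * (#|Y|%:R * (g%:R * ((r%:R + 1) * t%:R)))
      - alpha / 4 * lam <= _).
    by rewrite lerD2r; apply: ler_wpM2l.
  rewrite /lam.
  have r1 : 1 <= r%:R :> R by rewrite ler1n -(ltr0n R).
  have -> : #|Y|%:R * - (g%:R * t%:R * r%:R * alpha ^+ 2 / 8) =
     (#|Y|%:R * g%:R * t%:R * alpha ^+ 2) * (- r%:R / 8) by rewrite expr2; lra.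
  have -> : (alpha / 4) ^+ 2 * (#|Y|%:R * (g%:R * ((r%:R + 1) * t%:R))) -
    alpha / 4 * (#|Y|%:R * (g%:R * t%:R * r%:R * alpha)) =
     (#|Y|%:R * g%:R * t%:R * alpha ^+ 2) * ((r%:R + 1) / 16 - r%:R / 4).
    by rewrite !expr2; lra.
  apply: ler_wpM2l; last by lra.
  by rewrite !mulr_ge0 // ltW.
apply: le_trans (_ : expect (fun F => \sum_(f in D) ([disjoint F & Z] &&
    (lam <= \sum_(p in S f) ((edge_of p \in F)%:R - 1 / 2)))%:R) <= _).
  apply: expect_le => F FE; case: [disjoint F & Z]; last first.
    by rewrite sumr_ge0.
  have [/forall_inP allbad|_] := boolP [forall b in Y, bad F b]; last by rewrite sumr_ge0.
  pose f : {ffun B -> J} := [ffun b => if b \in Y then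
    odflt j0 [pick UA | admissible UA && crowded F b UA] else j0].
  have fP b : b \in Y -> admissible (f b) && crowded F b (f b).
    move=> bY; rewrite /f ffunE bY; case: pickP => //= none.
    by have /existsP[UA] := allbad _ bY; rewrite none.
  have fD : f \in D.
    apply/pffun_onP; split.
      by apply/fintype.subsetP => b; rewrite !inE /f ffunE; case: ifP => //; rewrite eqxx.
    by move=> _ /fintype.imageP[b bY ->]; have /andP[] := fP _ bY.
  rewrite (bigD1 f) //= -[X in X <= _]addr0; apply: lerD; last by rewrite sumr_ge0.
  suff -> : lam <= \sum_(p in S f) ((edge_of p \in F)%:R - 1 / 2) by [].
  rewrite sumS /lam mulr_natl -sumr_const; apply: ler_sum => b bY.
  have /andP[_ crowd] := fP _ bY.
  have -> : \sum_(i in (f b).1) \sum_(y in reach (f b).2 b)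
      ((edge_of (((b, i) : blowup), y) \in F)%:R - 1 / 2) =
    \sum_(i in (f b).1) \sum_(y in reach (f b).2 b)
       (edge_of (((b, i) : blowup), y) \in F)%:R -
    \sum_(i in (f b).1) #|reach (f b).2 b|%:R / 2 :> R.
    rewrite -sumrB; apply: eq_bigr => i _; rewrite sumrB sumr_const.
    by rewrite -[_ *+ #|_|]mulr_natl; lra.
  have half_reach : \sum_(i in (f b).1) #|reach (f b).2 b|%:R / 2 <=
      g%:R * ((r%:R + 1) * t%:R / 2) :> R.
    rewrite -(cardU f b) // [leRHS]mulr_natl -[leRHS]sumr_const; apply: ler_sum => i iU.
    by apply: ler_wpM2r => //; apply: reach_le.
  apply: le_trans (lerB crowd half_reach).
  have -> : g%:R * t%:R * r%:R * alpha = g%:R * t%:R * (r%:R * alpha) by lra.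
  have -> : g%:R * (thr - alpha / 4 * k) - g%:R * ((r%:R + 1) * t%:R / 2) =
      g%:R * t%:R * (3 / 2 * (r%:R * alpha) - 1 / 2).
    by rewrite /threshold !natrM; lra.
  apply: ler_wpM2l; first by rewrite mulr_ge0 // ltW.
  by have := r_large; lra.
rewrite expect_sum; apply: le_trans (ler_sum _ term) _.
rewrite sumr_const -mulrnAr; apply: ler_wpM2l; first by rewrite invr_ge0 exprn_ge0.
rewrite -mulr_natl card_pffun_on exprMn natrX; apply: ler_wpM2r.
  by rewrite exprn_ge0 // expR_ge0.
rewrite lerXn2r ?nnegrE ?exprn_ge0 // -natrX ler_nat.
apply: leq_trans (max_card _) _.
by rewrite card_prod !card_set card_prod !card_ord card_bool -expnD (mulnC r).
Qed.
End Blowup.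

(** * The helix *)
Lemma Zp_int_inj (q : nat) (x y : int) : (1 < q)%N -> `|x - y| < q%:Z ->
  x%:~R = y%:~R :> 'Z_q -> x = y.
Proof.
move=> q1; wlog le_yx : x y / y <= x => [wl xy e|].
  have [le|/ltW le] := lerP y x; first exact: wl.
  by apply/esym/wl => //; rewrite distrC.
move=> xy /eqP; rewrite -subr_eq0 -rmorphB /=.
have -> : x - y = (`|x - y|%N)%:Z by move: le_yx; clear; lia.
rewrite -pmulrn => /eqP /(congr1 val) /=; rewrite val_Zp_nat // modn_small.
  by move: le_yx; clear; lia.
by move: xy le_yx; clear; lia.
Qed.

Lemma small_multiple (d w : int) : `|d * w| < w -> d = 0.
Proof.
rewrite normrM => lt; have w0 : 0 < w by apply: le_lt_trans lt; rewrite mulr_ge0.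
rewrite (gtr0_norm w0) -[X in _ < X]mul1r ltr_pM2r // in lt.
by move: lt; clear; lia.
Qed.

Lemma seed_radius_ge (r : nat) : (0 < r)%N -> (r <= seed_radius r)%N.
Proof. by rewrite /seed_radius !expnS expn0 muln1; nia. Qed.

(** The base graph has N.+1 copies of Z_Q, made of m windows of length L. *)
Section Helix.
Variables (r h t N m : nat).
Hypothesis r_gt0 : (0 < r)%N.
Hypothesis h_gt0 : (0 < h)%N.
Hypothesis m_large : (9 <= m)%N.

Local Notation W := (pitch r h).
Local Notation L := (W ^ 2)%N.
Local Notation Q := (m * L)%N.
Definition base : finType := ('I_N.+1 * 'Z_Q)%type.

Definition helix_pos (c : 'I_N.+1) (x : int) : base := (c, x%:~R).
Definition helix_nb (d : 'I_r * bool) (b : base) : base :=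
  (b.1, b.2 + (offset W d)%:~R).

Lemma pitch_ge : ((2 * seed_radius r + 3) ^ 2 <= W)%N.
Proof. by rewrite leq_pmull. Qed.

(** Seeds in different windows are far apart. *)
Lemma slack : (2 * ((seed_radius r).+1 * W + (seed_radius r + r)) + 4 * (W + r) < L)%N.
Proof.
move: pitch_ge (seed_radius_ge r_gt0); rewrite -!mulnn; set w := W; set q := seed_radius r; nia.
Qed.

Lemma LQ : (9 * L <= Q)%N.
Proof. by rewrite leq_mul2r m_large orbT. Qed.

Lemma Q_gt1 : (1 < Q)%N.
Proof. by have := slack; have := LQ; move: Q L; clear; lia. Qed.

Lemma pos_inj c c' x y : `|x - y| < Q%:Z -> helix_pos c x = helix_pos c' y -> c = c' /\ x = y.
Proof. by move=> xy [-> /(Zp_int_inj Q_gt1 xy) ->]. Qed.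

Lemma offset_reverse d : offset W (@reverse r d) = - offset W d.
Proof. by case: d => a [] //=; rewrite /offset /= opprK. Qed.

Lemma offset_le d : 0 < `|@offset r W d| <= (W + r)%N%:Z.
Proof.
have := pitch_ge; case: d => a [] /=; have := ltn_ord a; rewrite /offset /= ?normrN;
by rewrite -mulnn; clear; set w := W; set q := seed_radius r; lia.
Qed.

Lemma helix_nbK d b : helix_nb (reverse d) (helix_nb d b) = b.
Proof. by case: b => c z; rewrite /helix_nb offset_reverse /= rmorphN addrK. Qed.

Lemma helix_nb_neq d b : helix_nb d b != b.
Proof.
case: b => c z; apply/eqP => -[/eqP]; rewrite -subr_eq0 addrC addKr => /eqP e.
have := @Zp_int_inj Q (offset W d) 0 Q_gt1; rewrite subr0 => /(_ _ e).
have /andP[d0 dW] := offset_le d; have := slack; have := LQ => LQ sl.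
have ltQ : `|offset W d| < Q%:Z.
  by apply: le_lt_trans dW _; move: sl LQ; move: L Q; clear; lia.
by move=> /(_ ltQ) d00; rewrite d00 normr0 ltxx in d0.
Qed.

Lemma helix_nb_inj b : injective (helix_nb ^~ b).
Proof.
move=> [a s] [a' s'] /(congr1 snd) /= e0.
have e1 : (offset W (a, s))%:~R = (offset W (a', s'))%:~R :> 'Z_Q := addrI _ e0.
have e := fun lt => Zp_int_inj Q_gt1 lt e1.
have sW : `|offset W (a, s) - offset W (a', s')| < Q%:Z.
  have /andP[_ h1] := offset_le (a, s); have /andP[_ h2] := offset_le (a', s').
  have := slack; have := LQ; move: h1 h2; move: L Q; clear => l q; lia.
move: {e} (e sW) => e; clear e0 e1 sW; have := ltn_ord a; have := ltn_ord a'.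
have : (0 < W)%N by have := pitch_ge; rewrite -mulnn; clear; lia.
move=> w0 _ _; move: e; rewrite /offset; move: s s' => [] [] /= e; try (by lia);
by congr (_, _); apply: val_inj => /=; lia.
Qed.

Definition helix : sgraph := blowup t helix_nbK helix_nb_neq.

Lemma card_helix : #|helix| = (N.+1 * Q * t)%N.
Proof. by rewrite !card_prod !card_ord Zp_cast // Q_gt1. Qed.

Lemma helix_nb_pos d c x : helix_nb d (helix_pos c x) = helix_pos c (x + offset W d).
Proof. by rewrite /helix_nb /helix_pos rmorphD. Qed.

Lemma posDQ c x (n : nat) : helix_pos c (x + (n * Q)%N%:Z) = helix_pos c x.
Proof.
have Q0 : Q%:R = 0 :> 'Z_Q by rewrite pchar_Zp // Q_gt1.
by rewrite /helix_pos rmorphD /= -pmulrn natrM Q0 mulr0 addr0.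
Qed.

Local Notation K1 := (2 * seed_radius r + 3)%N.
Local Notation K2 := (2 * (seed_radius r + r) + 1)%N.
(** Every edge has a unique description by its tail, the end from which it goes
in a direction (a, true), the number a and the indices inside the two blocks. A
seed consists of the edges with tail in a box that contains the disc and its
neighbours in the directions (a, false), so all edges at the disc. A box is
used because its size is the same for all seeds. *)
Definition seed_index : finType := ('I_K1 * 'I_K2 * ('I_t * 'I_r * 'I_t))%type.

Definition tail_pos (j x y : nat) : int :=
  (j * L)%N%:Z + (x%:Z - (seed_radius r).+1%:Z) * W%:Z + (y%:Z - (seed_radius r + r)%N%:Z).

Definition seed_arc (c : 'I_N.+1) (j : nat) (p : seed_index) : helix * helix :=
  let: (x, y, (i, a, i')) := p in
  let b := helix_pos c (tail_pos j x y) in ((b, i), (helix_nb (a, true) b, i')).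

Definition seed c j : {set {set helix}} := [set edge_of (seed_arc c j p) | p : seed_index].

Lemma tail_pos_inj j j' x x' y y' : (x < K1)%N -> (x' < K1)%N -> (y < K2)%N ->
  (y' < K2)%N -> tail_pos j x y = tail_pos j' x' y' -> [/\ j = j', x = x' & y = y'].
Proof.
rewrite /tail_pos => xK xK' yK yK' e.
have WK : (K2 <= W)%N.
  move: pitch_ge (seed_radius_ge r_gt0); rewrite -mulnn; set w := W; set q := seed_radius r.
  by clear; nia.
have sl := slack.
have xW : `|(x%:Z - x'%:Z) * W%:Z| <= 2 * ((seed_radius r).+1%:Z * W%:Z).
  rewrite normrM mulrA; apply: ler_pM => //; move: xK xK'; clear; lia.
have yW : `|y%:Z - y'%:Z| <= 2 * (seed_radius r + r)%N%:Z by move: yK yK'; clear; lia.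
have jj : j = j'.
  have eL : (j%:Z - j'%:Z) * L%:Z = (x'%:Z - x%:Z) * W%:Z + (y'%:Z - y%:Z).
    by move: e; rewrite !PoszM; move: L W; clear; lia.
  have : `|(j%:Z - j'%:Z) * L%:Z| < L%:Z.
    rewrite eL; apply: le_lt_trans (ler_normD _ _) _.
    rewrite -(opprB x%:Z) mulNr normrN [X in _ + X]distrC.
    by move: xW yW sl; set a := `|_|; set b := `|_|; move: L; clear; set w := W; lia.
  by move/small_multiple; clear; lia.
subst j'; have xy : (x%:Z - x'%:Z) * W%:Z = y'%:Z - y%:Z by move: e; clear; lia.
have /small_multiple xx : `|(x%:Z - x'%:Z) * W%:Z| < W%:Z.
  by rewrite xy; move: yK yK' WK; set w := W; set q := (_ + r)%N; clear; lia.
by rewrite xx mul0r in xy; move: xx xy; clear; split => //; lia.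
Qed.

Lemma tail_pos_bound j x y : (j < m)%N -> (x < K1)%N -> (y < K2)%N ->
  - ((seed_radius r).+1 * W + (seed_radius r + r))%N%:Z <= tail_pos j x y <=
  Q%:Z - L%:Z + ((seed_radius r).+1 * W + (seed_radius r + r))%N%:Z.
Proof.
move=> jm xK yK; rewrite /tail_pos.
have : `|(x%:Z - (seed_radius r).+1%:Z) * W%:Z| <= (seed_radius r).+1%:Z * W%:Z.
  by rewrite normrM; apply: ler_pM => //; move: xK; clear; lia.
have : `|y%:Z - (seed_radius r + r)%N%:Z| <= (seed_radius r + r)%N%:Z by move: yK; clear; lia.
have : (j * L + L <= Q)%N by rewrite -mulSnr leq_mul2r jm orbT.
set a := (x%:Z - _) * W%:Z; set b := y%:Z - _; set q := Q; set l := L.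
set s := (_ + r)%N; set w := W; clear; lia.
Qed.

(** Positions in windows are determined modulo Q since they span less than Q,
and an edge cannot be traversed backwards in a direction (a, true) since
2W + a + a' does not vanish modulo Q. *)
Lemma seed_arc_inj c (j j' : 'I_m) p p' :
  edge_of (seed_arc c j p) = edge_of (seed_arc c j' p') -> j = j' /\ p = p'.
Proof.
case: p => [[x y] [[i a] i']]; case: p' => [[x' y'] [[i1 a1] i1']] e.
have b1 := tail_pos_bound (ltn_ord j) (ltn_ord x) (ltn_ord y).
have b2 := tail_pos_bound (ltn_ord j') (ltn_ord x') (ltn_ord y').
have sl := slack; have lq := LQ.
have ar := ltn_ord a; have ar1 := ltn_ord a1.
have near (s : int) : `|s| <= 2 * (W + r)%N%:Z ->
    `|tail_pos j x y - tail_pos j' x' y' + s| < Q%:Z.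
  move: b1 b2 sl lq; set z1 := tail_pos j x y; set z2 := tail_pos j' x' y'.
  set q := Q; set l := L; set s1 := (_.+1 * W)%N; set s2 := (_ + r)%N.
  by set s3 := (W + r)%N; clear; lia.
have W0 : (0 < W)%N by have := pitch_ge; rewrite -mulnn; clear; lia.
have : (seed_arc c j (x, y, (i, a, i'))).1 \in
   edge_of (seed_arc c j' (x', y', (i1, a1, i1'))) by rewrite -e set21.
have : (seed_arc c j (x, y, (i, a, i'))).2 \in
   edge_of (seed_arc c j' (x', y', (i1, a1, i1'))) by rewrite -e set22.
rewrite /edge_of !inE /seed_arc !helix_nb_pos.
set z := tail_pos j x y in near *; set z' := tail_pos j' x' y' in near *.
have unpos u v : (z + u)%:~R = (z' + v)%:~R :> 'Z_Q ->
    `|u - v| <= 2 * (W + r)%N%:Z -> z + u = z' + v.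
  move=> zz uv; apply: (Zp_int_inj Q_gt1 _ zz).
  by rewrite opprD addrACA; apply: near.
have posE (u : int) : helix_pos c u = helix_pos c (u + 0) by rewrite addr0.
rewrite [helix_pos c z]posE [helix_pos c z']posE /offset /=.
have small1 (b : 'I_r) : `|(W + b)%N%:Z - 0| <= 2 * (W + r)%N%:Z.
  by have := ltn_ord b; clear; lia.
have small2 (b : 'I_r) : `|0 - (W + b)%N%:Z| <= 2 * (W + r)%N%:Z.
  by have := ltn_ord b; clear; lia.
have small3 (b b' : 'I_r) : `|(W + b)%N%:Z - (W + b')%N%:Z| <= 2 * (W + r)%N%:Z.
  by have := ltn_ord b; have := ltn_ord b'; clear; lia.
case/orP=> /eqP[/unpos H2 e2] /orP[]/eqP[/unpos H1 e1].
- move: (H2 (small1 _)) (H1 isT); move: W0; clear; set w := W; lia.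
- move: (H2 (small1 _)) (H1 (small2 _)); move: W0; clear; set w := W; lia.
- have zz : z = z' by move: (H1 isT); clear; lia.
  have aa : a = a1.
    by apply: val_inj => /=; move: (H2 (small3 _ _)) zz; clear; lia.
  have [jj xx yy] := tail_pos_inj (ltn_ord x) (ltn_ord x') (ltn_ord y) (ltn_ord y') zz.
  by split; [exact: val_inj | rewrite e1 e2 aa (val_inj xx) (val_inj yy)].
- move: (H2 (small3 _ _)) (H1 (small2 _)); move: W0; clear; set w := W; lia.
Qed.

Lemma seed_sub c j : seed c j \subset edges helix.
Proof.
apply/fintype.subsetP => e /imsetP[[[x y] [[i a] i']] _ ->].
by apply: edge_ofE; apply/existsP; exists (a, true).
Qed.

Definition seed_size := (K1 * K2 * (t * r * t))%N.

Lemma card_seed c (j : 'I_m) : #|seed c j| = seed_size.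
Proof.
rewrite card_imset ?card_prod ?card_ord // => p p' e.
by have [] := @seed_arc_inj c j j p p' e.
Qed.

Lemma seed_disjoint c (j j' : 'I_m) : j != j' -> [disjoint seed c j & seed c j'].
Proof.
move=> /eqP jj; rewrite -setI_eq0; apply/set0Pn => -[e]; rewrite inE.
move=> /andP[/imsetP[p _ ->] /imsetP[p' _ e']].
by have [] := seed_arc_inj e'.
Qed.


Variables (R : realType) (alpha : R).
Hypothesis alpha_gt0 : 0 < alpha.
Hypothesis alpha_le1 : alpha <= 1.
Hypothesis r_large : 1 <= r%:R * alpha.
Hypothesis t_gt0 : (0 < t)%N.
Implicit Types (F : {set {set helix}}).
Local Notation thr := (threshold r t alpha).

Lemma threshold_gt0 : 0 < thr.
Proof.
have k0 : 0 < (2 * r * t)%:R :> R by rewrite ltr0n !muln_gt0 r_gt0.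
by rewrite /threshold; have := alpha_gt0; nra.
Qed.

(** Without edges, the vertices in the disc have degree zero and are not in the
core. *)
Lemma seed_dead F c (j : nat) : F \subset edges helix -> [disjoint F & seed c j] ->
  dead_disc r h (fun x => alive alpha F (helix_pos c x)) (j * L)%N%:Z (seed_radius r ^ 2).
Proof.
move=> FE Fj u v uv; apply/negP => /(leq_ltn_trans (leq0n _)).
rewrite card_gt0 => /set0Pn[i]; rewrite inE => /core_degree thr_le.
have : 0 < #|nbrs_in F (core thr F) ((helix_pos c ((j * L)%N%:Z + u * W%:Z + v), i) : helix)|%:R :> R.
  exact: lt_le_trans threshold_gt0 thr_le.
rewrite ltr0n card_gt0 => /set0Pn[[b i']]; rewrite !inE => /andP[_ /andP[]].
case/existsP=> -[a s] /= /eqP -> eF.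
set x := _ + v in eF *.
have : edge_of (((helix_pos c x, i) : helix), (helix_nb (a, s) (helix_pos c x), i')) \in seed c j.
  rewrite -mulnn PoszM in uv.
  have hu : `|u| <= (seed_radius r)%:Z by move: uv; clear; nia.
  have hv : `|v| <= (seed_radius r)%:Z by move: uv; clear; nia.
  have ar := ltn_ord a.
  case: s eF => eF.
    have xK : (absz (u + (seed_radius r).+1%:Z)%R < K1)%N by move: hu; clear; lia.
    have yK : (absz (v + (seed_radius r + r)%N%:Z)%R < K2)%N by move: hv; clear; lia.
    apply/imsetP; exists (Ordinal xK, Ordinal yK, (i, a, i')) => //=.
    have -> // : tail_pos j (absz (u + (seed_radius r).+1%:Z)%R)
                  (absz (v + (seed_radius r + r)%N%:Z)%R) = x.
    rewrite /tail_pos /x !gez0_abs ?addrK //; first by move: hv; clear; lia.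
    by move: hu; clear; lia.
  have xK : (absz (u - 1 + (seed_radius r).+1%:Z)%R < K1)%N by move: hu; clear; lia.
  have yK : (absz (v - a%:Z + (seed_radius r + r)%N%:Z)%R < K2)%N by move: hv ar; clear; lia.
  apply/imsetP; exists (Ordinal xK, Ordinal yK, (i', a, i)) => //=.
  have -> : tail_pos j (absz (u - 1 + (seed_radius r).+1%:Z)%R)
       (absz (v - a%:Z + (seed_radius r + r)%N%:Z)%R) = x + offset W (a, false).
    rewrite /tail_pos /x !gez0_abs ?addrK.
    - by rewrite /offset /=; clear; lia.
    - by move: hv ar; clear; lia.
    - by move: hu; clear; lia.
  by rewrite -helix_nb_pos (helix_nbK (a, false)) /edge_of /= finset.setUC.
by move=> es; have := disjointFr Fj eF; rewrite es.
Qed.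

Local Notation X := (6 * L).+1.

Definition window_bad F (b : base) (i : 'I_X) :=
  bad alpha F (b.1, b.2 + ((i : nat)%:Z - (3 * L)%N%:Z)%:~R).

(** The deterministic part, transported from the integers to Z_Q. Windows are
numbered by all naturals from j on, going around Z_Q, so that each point of Z_Q
lies in a window after the seed. *)
Lemma helix_dies F c (b : base) : F \subset edges helix -> b.1 = c ->
  (forall j : 'I_m, #|[set i | window_bad F (helix_pos c (j * L)%N%:Z) i]| < h)%N ->
  (exists j : 'I_m, [disjoint F & seed c j]) ->
  (forall (j : 'I_m) i, [disjoint F & seed c j] ->
     ~~ window_bad F (helix_pos c (j * L)%N%:Z) i) ->
  (forall i, ~~ window_bad F b i) -> ~~ alive alpha F b.
Proof.
case: b => c' z FE /= -> few [j seedj] nbad_seed nbad.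
pose al x := alive alpha F (helix_pos c x).
pose bd x := bad alpha F (helix_pos c x).
have L0 : (0 < L)%N by have := slack; move: L; clear; lia.
have wbE n i : window_bad F (helix_pos c (n * L)%N%:Z) i =
    bd ((n * L)%N%:Z - (3 * L)%N%:Z + (i : nat)%:Z).
  by rewrite /window_bad /bd /helix_pos /= -rmorphD /=; congr (bad _ _ (_, _%:~R)); clear; lia.
have rule x : ~~ bd x -> (#|[pred d : 'I_r * bool | al (x + offset W d)%R]| <= r.+1)%N -> ~~ al x.
  move=> nb le; apply: alive_rule => //; apply: leq_trans _ le.
  by apply: eq_leq; apply: eq_card => d; rewrite !inE helix_nb_pos.
(* One more turn puts the point after window j. *)
pose zz : int := (val z)%:Z + (1 * Q)%N%:Z.
have zE : helix_pos c zz = (c, z).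
  by rewrite /zz posDQ /helix_pos -pmulrn natr_Zp.
have jm := ltn_ord j.
rewrite -zE; apply: (infection_spreads r_gt0 h_gt0 rule (j0 := j)).
- move=> n _; rewrite /few_bad.
  have nm : (n %% m < m)%N by rewrite ltn_pmod //; move: m_large; clear; lia.
  apply: leq_ltn_trans (few (Ordinal nm)); apply: subset_leq_card.
  apply/fintype.subsetP => i; rewrite !inE wbE /=; congr (is_true _).
  rewrite /bd -[in RHS](posDQ c _ (n %/ m)); congr (bad _ _ (helix_pos _ _)).
  rewrite {1}(divn_eq n m); clear; lia.
- move=> x xj.
  have iX : (absz (x - ((j * L)%N%:Z - (3 * L)%N%:Z))%R < X)%N.
    by move: xj; set jl := (j * L)%N; move: L; clear; lia.
  have := nbad_seed j (Ordinal iX) seedj; rewrite wbE /= gez0_abs; last first.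
    by move: xj; set jl := (j * L)%N; move: L; clear; lia.
  by rewrite addrC subrK.
- exact: seed_dead.
- rewrite /zz mul1n; have : (j * L <= Q)%N by rewrite leq_mul2r ltnW ?orbT.
  by set a := (j * L)%N; set q := Q; clear; lia.
move=> x xz.
have iX : (absz (x - zz + (3 * L)%N%:Z)%R < X)%N.
  by move: xz; clear; set l := L; lia.
have zR : zz%:~R = z := congr1 snd zE.
have := nbad (Ordinal iX); rewrite /window_bad /= -zR -rmorphD /=.
rewrite gez0_abs ?addrK; last by move: xz; clear; set l := L; lia.
by rewrite addrC subrK.
Qed.

Local Notation q := (bad_rate r t alpha).

Definition window_pt (b : base) (i : 'I_X) : base :=
  (b.1, b.2 + ((i : nat)%:Z - (3 * L)%N%:Z)%:~R).

Lemma window_pt_inj b : injective (window_pt b).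
Proof.
move=> i j /(congr1 snd) /= ij0; apply: val_inj => /=.
have ij := fun lt => Zp_int_inj Q_gt1 lt (addrI _ ij0).
have := LQ; have := ltn_ord i; have := ltn_ord j => jX iX lq.
suff : (i : nat)%:Z - (3 * L)%N%:Z = (j : nat)%:Z - (3 * L)%N%:Z by clear; lia.
apply: ij; move: iX jX lq slack; set l := L; set u := Q; move: (i : nat) (j : nat).
by clear; lia.
Qed.

Lemma expect_window_bad b (Z : {set {set helix}}) : Z \subset edges helix ->
  expect (fun F : {set {set helix}} => ([disjoint F & Z] && [exists i, window_bad F b i])%:R) <=
  X%:R * (2 ^- #|Z| * q).
Proof.
move=> ZE; apply: le_trans (_ : expect (fun F : {set {set helix}} => \sum_(i < X)
   ([disjoint F & Z] && [forall b' in [set window_pt b i], bad alpha F b'])%:R) <= _).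
  apply: expect_le => F _; case: [disjoint F & Z] => /=; last by rewrite sumr_ge0.
  have [/existsP[i bi]|_] := boolP [exists i, window_bad F b i]; last by rewrite sumr_ge0.
  rewrite (bigD1 i) //= -[X in X <= _]addr0; apply: lerD; last by rewrite sumr_ge0.
  suff -> : [forall b' in [set window_pt b i], bad alpha F b'] by [].
  by apply/forall_inP => b'; rewrite inE => /eqP ->.
rewrite expect_sum mulr_natl -[X in _ *+ X]card_ord -sumr_const.
apply: ler_sum => i _; apply: le_trans (bad_bound _ _ _ _ _ ZE) _ => //.
by rewrite cards1.
Qed.

Lemma expect_window_crowded b :
  expect (fun F : {set {set helix}} => (h <= #|[set i | window_bad F b i]|)%N%:R) <= 2 ^+ X * q ^+ h.
Proof.
apply: le_trans (_ : expect (fun F : {set {set helix}} => \sum_(Y : {set 'I_X} | #|Y| == h)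
   ([disjoint F & finset.set0] &&
    [forall b' in [set window_pt b i | i in Y], bad alpha F b'])%:R) <= _).
  apply: expect_le => F _; case: leqP => /= [le|_]; last by rewrite sumr_ge0.
  set C := [set i | _] in le; pose Y := [set i in take h (enum C)].
  have YC : Y \subset C.
    by apply/fintype.subsetP => i; rewrite inE => /mem_take; rewrite mem_enum.
  have cY : #|Y| == h.
    rewrite cardsE; have /card_uniqP -> : uniq (take h (enum C)).
      by rewrite take_uniq // enum_uniq.
    by rewrite size_take -cardE; case: ltngtP le => // <-.
  rewrite (bigD1 Y) //= -[X in X <= _]addr0; apply: lerD; last by rewrite sumr_ge0.
  have -> /= : [disjoint F & finset.set0] by rewrite -setI_eq0 finset.setI0.
  suff -> : [forall b' in [set window_pt b i | i in Y], bad alpha F b'] by [].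
  apply/forall_inP => b' /imsetP[i /(fintype.subsetP YC)]; rewrite inE => bi ->.
  exact: bi.
have term (Y : {set 'I_X}) : #|Y| == h ->
    expect (fun F : {set {set helix}} => ([disjoint F & finset.set0] &&
      [forall b' in [set window_pt b i | i in Y], bad alpha F b'])%:R) <= q ^+ h.
  move=> /eqP cY; apply: le_trans (bad_bound _ _ _ _ _ (finset.sub0set _)) _ => //.
  by rewrite cards0 expr0 invr1 mul1r (card_imset _ (@window_pt_inj b)) cY.
rewrite expect_sum; apply: le_trans (ler_sum _ term) _.
rewrite sumr_const -[leLHS]mulr_natl; apply: ler_wpM2r.
  by rewrite exprn_ge0 ?bad_rate_ge0.
rewrite -natrX ler_nat; apply: leq_trans (max_card _) _.
by rewrite card_set card_ord.
Qed.

(** In this order: some window has h bad blocks, no seed occurs, a bad block is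
close to a seed that occurs, a bad block is close to a neighbour of the given
vertex. *)
Definition failure : R :=
  m%:R * (2 ^+ X * q ^+ h) + (1 - 2 ^- seed_size) ^+ m +
  m%:R * (X%:R * (2 ^- seed_size * q)) + (2 * r)%:R * (X%:R * q).

Lemma expect_core_vertex (v : helix) : expect (fun F : {set {set helix}} => (v \in core thr F)%:R) <= failure.
Proof.
case: v => [[c z] i0]; set b := (c, z).
pose j0 (j : 'I_m) := helix_pos c (j * L)%N%:Z.
apply: le_trans (_ : expect (fun F : {set {set helix}} =>
    \sum_(j < m) (h <= #|[set i | window_bad F (j0 j) i]|)%N%:R +
    [forall j : 'I_m, ~~ [disjoint F & seed c j]]%:R +
    \sum_(j < m) ([disjoint F & seed c j] && [exists i, window_bad F (j0 j) i])%:R +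
    \sum_(d : 'I_r * bool) ([disjoint F & finset.set0] &&
       [exists i, window_bad F (helix_nb d b) i])%:R) <= _).
  apply: expect_le => F FE.
  have sum_ge0 (I : finType) (f : I -> bool) : 0 <= \sum_i (f i)%:R :> R by rewrite sumr_ge0.
  have sum_ge1 (I : finType) (f : I -> bool) : [exists i, f i] -> 1 <= \sum_i (f i)%:R :> R.
    move=> /existsP[i fi]; rewrite (bigD1 i) //= fi lerDl.
    by rewrite sumr_ge0.
  set s1 := \sum_(j < m) _; set s2 := [forall j, _]%:R.
  set s3 := \sum_(j < m) _; set s4 := \sum_d _.
  have [p1 p2 p3 p4] : [/\ 0 <= s1, 0 <= s2, 0 <= s3 & 0 <= s4].
    by split=> //; apply: sum_ge0.
  have [vcore|_] := boolP (_ \in _); last by rewrite !addr_ge0.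
  rewrite [X in X <= _](_ : _ = 1) //.
  have [d ald] := core_near_alive alpha_gt0 r_large t_gt0 vcore.
  have [/sum_ge1|few] := boolP [exists j : 'I_m, (h <= #|[set i | window_bad F (j0 j) i]|)%N].
    by rewrite -/s1; lra.
  have [met|] := boolP [forall j : 'I_m, ~~ [disjoint F & seed c j]].
    have : 1 <= s2 by rewrite /s2 met.
    by move: p1 p3 p4; rewrite /=; lra.
  rewrite negb_forall => /existsP[j]; rewrite negbK => Fj.
  have [/sum_ge1|spoilt] := boolP [exists j : 'I_m,
      [disjoint F & seed c j] && [exists i, window_bad F (j0 j) i]].
    by rewrite -/s3; lra.
  suff /sum_ge1 : [exists d, [disjoint F & finset.set0] &&
      [exists i, window_bad F (helix_nb d b) i]] by rewrite -/s4; lra.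
  apply/existsP; exists d; rewrite -setI_eq0 finset.setI0 eqxx /=.
  apply: contraTT ald; rewrite negb_exists => /forallP nbad.
  apply: (helix_dies (c := c)) => //.
  - move=> j'; rewrite ltnNge; apply: contra few => le.
    by apply/existsP; exists j'.
  - by exists j.
  - move=> j' i Fj'; apply: contra spoilt => bi; apply/existsP; exists j'.
    by rewrite Fj'; apply/existsP; exists i.
rewrite !expectD !expect_sum /failure; apply: lerD; last first.
  rewrite [leRHS]mulr_natl (_ : (2 * r)%N = #|{: 'I_r * bool}|); last first.
    by rewrite card_prod card_ord card_bool mulnC.
  rewrite -sumr_const; apply: ler_sum => d _.
  apply: le_trans (expect_window_bad _ (finset.sub0set _)) _.
  by rewrite cards0 expr0 invr1 mul1r.
apply: lerD; last first.
  rewrite [leRHS]mulr_natl -[X in _ *+ X](card_ord m) -sumr_const.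
  apply: ler_sum => j _.
  apply: le_trans (expect_window_bad _ (seed_sub _ _)) _.
  by rewrite card_seed.
apply: lerD.
  rewrite [leRHS]mulr_natl -[X in _ *+ X](card_ord m) -sumr_const.
  by apply: ler_sum => j _; apply: expect_window_crowded.
rewrite (@expect_all_met _ _ _ _ seed_size) ?card_ord //.
- by move=> j; apply: seed_sub.
- by move=> j; apply: card_seed.
- by move=> j j'; apply: seed_disjoint.
Qed.

Lemma expect_core : expect (fun F : {set {set helix}} => #|core thr F|%:R) <= #|helix|%:R * failure.
Proof.
apply: le_trans (_ : expect (fun F : {set {set helix}} => \sum_(v : helix) (v \in core thr F)%:R) <= _).
  apply: expect_le => F _; rewrite -sum1_card natr_sum big_mkcond /=.
  by apply: ler_sum => v _; case: ifP.
rewrite expect_sum mulr_natl -sumr_const; apply: ler_sum => v _.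
exact: expect_core_vertex.
Qed.
End Helix.

(** * Choice of the constants *)
Lemma two_pow_le_expR (R : realType) (n : nat) : 2 ^+ n <= expR n%:R :> R.
Proof.
rewrite -[n%:R]mulr1 expRM_natl lerXn2r ?nnegrE ?expR_ge0 //.
exact: (expR_ge1Dx 1).
Qed.

Lemma nat_le_expR (R : realType) (x : R) : x <= expR x.
Proof. by have := expR_ge1Dx x; lra. Qed.

(** The number of choices 2^(t + 2r) is absorbed by half of the exponent, which
is quadratic in t; as t + 2r <= 3rt, this needs t at least 3 * 64 / alpha^3. *)
Lemma bad_rate_le (R : realType) (alpha : R) (r t : nat) :
  0 < alpha -> (0 < r)%N -> 192 / alpha ^+ 3 <= t%:R ->
  bad_rate r t alpha <= expR (- (alpha ^+ 3 * r%:R / 64 * t%:R ^+ 2)).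
Proof.
move=> a0 r0 tlarge.
have a3 : 0 < alpha ^+ 3 by rewrite exprn_gt0.
have t0 : 0 < t%:R :> R by apply: lt_le_trans tlarge; rewrite divr_gt0.
have r1 : 1 <= r%:R :> R by rewrite ler1n.
have t1 : 1 <= t%:R :> R by rewrite ler1n -(ltr0n R).
rewrite /bad_rate; apply: le_trans (_ : expR (t + 2 * r)%:R *
   expR (- (quorum t alpha * t * r)%:R * alpha ^+ 2 / 8) <= _).
  rewrite !natrM mulNr -mulNr mulNr; apply: ler_pM; rewrite ?expR_ge0 ?exprn_ge0 //.
    exact: two_pow_le_expR.
  by rewrite ler_expR; lra.
rewrite -expRD ler_expR natrD !natrM.
have /andP[_ /ltW gq] := quorumP t a0.
rewrite ler_pdivrMr // in tlarge.
have g3 : alpha ^+ 3 * r%:R / 32 * t%:R ^+ 2 <=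
    (quorum t alpha)%:R * t%:R * r%:R * alpha ^+ 2 / 8.
  have -> : alpha ^+ 3 * r%:R / 32 * t%:R ^+ 2 =
    (alpha / 4 * t%:R) * (t%:R * r%:R * alpha ^+ 2 / 8) by rewrite !exprS expr0; field.
  have -> : (quorum t alpha)%:R * t%:R * r%:R * alpha ^+ 2 / 8 =
    (quorum t alpha)%:R * (t%:R * r%:R * alpha ^+ 2 / 8) by field.
  apply: ler_wpM2r => //.
  by rewrite !mulr_ge0 ?sqr_ge0 ?invr_ge0 // ltW.
have : t%:R + 2 * r%:R <= 3 * (r%:R * t%:R) :> R by nra.
have : 3 * (r%:R * t%:R) <= alpha ^+ 3 * r%:R / 64 * t%:R ^+ 2.
  have -> : alpha ^+ 3 * r%:R / 64 * t%:R ^+ 2 = (t%:R * alpha ^+ 3 / 64) * (r%:R * t%:R).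
    by rewrite expr2; field.
  by apply: ler_wpM2r; [rewrite mulr_ge0 // ltW | lra].
lra.
Qed.

(** The seed size n = n0 t^2 does not involve h, so h can be chosen such that
the bound exp(-c h t^2) for h bad blocks beats the number m = n 2^n of windows
by exp(-n); this m makes a missing seed equally unlikely. *)
Lemma failure_small (R : realType) (alpha : R) (r : nat) :
  0 < alpha -> alpha <= 1 -> (0 < r)%N ->
  exists (h t0 : nat) (C rate : R), [/\ (0 < h)%N, (0 < t0)%N, 0 < C, 0 < rate &
    forall t, (t0 <= t)%N -> exists2 m, (9 <= m)%N &
      failure r h t m alpha <= C * expR (- (rate * t%:R ^+ 2))].
Proof.
move=> a0 a1 r0.
pose c := alpha ^+ 3 * r%:R / 64.
have c0 : 0 < c by rewrite divr_gt0 // mulr_gt0 ?exprn_gt0 // ltr0n.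
pose n0 := ((2 * seed_radius r + 3) * (2 * (seed_radius r + r) + 1) * r)%N.
have seedE t : seed_size r t = (n0 * t ^ 2)%N by rewrite /seed_size /n0 -mulnn; ring.
have n0_ge9 : (9 <= n0)%N.
  have := seed_radius_ge r0; rewrite /n0; set p := seed_radius r => rp.
  apply: leq_trans (_ : 5 * 5 * 1 <= _)%N => //.
  by apply: leq_mul => //; apply: leq_mul; move: r0 rp; clear; lia.
pose h := (Num.truncn (3 * n0%:R / c)).+1.
have ch : 3 * n0%:R <= c * h%:R.
  have /andP[_ /ltW] : (Num.truncn (3 * n0%:R / c))%:R <= 3 * n0%:R / c < h%:R.
    by apply: Num.Theory.truncn_itv; rewrite divr_ge0 ?mulr_ge0 // ltW.
  by rewrite ler_pdivrMr // [c * _]mulrC.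
pose X := (6 * pitch r h ^ 2).+1.
pose t0 := (Num.truncn (192 / alpha ^+ 3)).+1.
pose C := 2 ^+ X + 1 + X%:R * (n0%:R * (2 / c)) + (2 * r)%:R * X%:R : R.
have C0 : 0 < C.
  by rewrite 2?ltr_wpDr ?addr_gt0 ?exprn_gt0 ?mulr_ge0 ?invr_ge0 ?(ltW c0).
exists h, t0, C, (c / 2); split=> // [|t tt0]; first by rewrite divr_gt0.
have tl : 192 / alpha ^+ 3 <= t%:R.
  have /andP[_ /ltW /le_trans] : (Num.truncn (192 / alpha ^+ 3))%:R <= 192 / alpha ^+ 3 < t0%:R.
    by apply: Num.Theory.truncn_itv; rewrite divr_ge0 // exprn_ge0 // ltW.
  by apply; rewrite ler_nat.
have t_gt0 : (0 < t)%N by apply: leq_trans tt0.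
pose n := seed_size r t.
have n9 : (9 <= n)%N by rewrite /n seedE; apply: leq_trans n0_ge9 _; rewrite leq_pmulr // expn_gt0 t_gt0.
exists (n * 2 ^ n)%N; first by apply: leq_trans n9 _; rewrite leq_pmulr // expn_gt0.
set x : R := t%:R ^+ 2.
have x0 : 0 <= x by rewrite sqr_ge0.
have nx : n%:R = n0%:R * x :> R by rewrite /n seedE natrM natrX.
have qle := bad_rate_le a0 r0 tl; rewrite -/c -/x in qle.
clearbody x.
have q0 := bad_rate_ge0 r t alpha.
set q := bad_rate r t alpha in qle q0 *.
have two_n : 2 ^+ n != 0 :> R by rewrite expf_neq0.
have c_n0 : c / 2 <= n0%:R.
  have : c <= r%:R.
    rewrite /c; have : alpha ^+ 3 <= 1 by rewrite exprn_ile1 // ltW.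
    have : 0 < alpha ^+ 3 by rewrite exprn_gt0.
    have : 0 <= r%:R :> R by [].
    nra.
  have : r%:R <= n0%:R :> R by rewrite ler_nat leq_pmull // muln_gt0 !addn_gt0 !orbT.
  lra.
have qD : q <= expR (- (c / 2 * x)) * expR (- (c / 2 * x)).
  by apply: le_trans qle _; rewrite -expRD ler_expR; lra.
set D := expR (- (c / 2 * x)) in qD *.
have D0 : 0 < D by exact: expR_gt0.
have D1 : D <= 1 by rewrite -expR0 ler_expR oppr_le0 !mulr_ge0 // ltW.
have seeds : expR (- (n0%:R * x)) <= D by rewrite ler_expR lerN2; apply: ler_wpM2r.
rewrite /failure -/n -/q.
have mE : (n * 2 ^ n)%N%:R = n%:R * 2 ^+ n :> R by rewrite natrM natrX.
have T1 : (n * 2 ^ n)%N%:R * (2 ^+ X * q ^+ h) <= 2 ^+ X * D.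
  rewrite mulrCA; apply: ler_wpM2l; first by rewrite exprn_ge0.
  apply: le_trans seeds; rewrite mE.
  apply: le_trans (_ : expR n%:R * expR n%:R * expR (- (c * x)) ^+ h <= _).
    apply: ler_pM; rewrite ?mulr_ge0 ?exprn_ge0 //.
      by apply: ler_pM; rewrite ?exprn_ge0 ?nat_le_expR ?two_pow_le_expR.
    by rewrite lerXn2r ?nnegrE ?expR_ge0.
  rewrite -expRM_natl -!expRD ler_expR nx.
  have : 3 * n0%:R * x <= c * h%:R * x by apply: ler_wpM2r.
  lra.
have T2 : (1 - 2 ^- n) ^+ (n * 2 ^ n) <= D.
  apply: le_trans seeds.
  apply: le_trans (_ : expR (- 2 ^- n) ^+ (n * 2 ^ n) <= _).
    rewrite lerXn2r ?nnegrE ?expR_ge0 ?expR_ge1Dx //.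
    by rewrite subr_ge0 invf_le1 ?exprn_gt0 // exprn_ege1 // ler1n.
  by rewrite -expRM_natl ler_expR mE mulrN -mulrA divff // mulr1 nx.
have T3 : (n * 2 ^ n)%N%:R * (X%:R * (2 ^- n * q)) <= X%:R * (n0%:R * (2 / c)) * D.
  have -> : (n * 2 ^ n)%N%:R * (X%:R * (2 ^- n * q)) = X%:R * (n0%:R * x * q).
    by rewrite mE nx; field.
  rewrite -!mulrA; apply: ler_wpM2l => //; apply: ler_wpM2l => //.
  have xD : x * D <= 2 / c.
    rewrite /D expRN ler_pdivrMr ?expR_gt0 //.
    rewrite [X in X <= _](_ : x = 2 / c * (c / 2 * x)); last first.
      by field; rewrite lt0r_neq0.
    apply: ler_wpM2l; last exact: nat_le_expR.
    by rewrite divr_ge0 // ltW.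
  apply: le_trans (_ : x * D * D <= _); first by rewrite -mulrA; apply: ler_wpM2l.
  by rewrite mulrA; apply: ler_wpM2r xD; apply: ltW.
have T4 : (2 * r)%:R * (X%:R * q) <= (2 * r)%:R * X%:R * D.
  rewrite -mulrA; apply: ler_wpM2l => //; apply: ler_wpM2l => //.
  by apply: le_trans qD _; rewrite ler_piMl // ltW.
rewrite /C 3!mulrDl [1 * D]mul1r.
exact: lerD (lerD (lerD T1 T2) T3) T4.
Qed.

Lemma expect1 (R : realType) (G : sgraph) : expect (fun _ : {set {set G}} => 1 : R) = 1.
Proof.
have := @expect_disjoint R G finset.set0 (finset.sub0set _).
rewrite cards0 expr0 invr1 => e; rewrite -[RHS]e; congr expect; apply/funext => F.
by rewrite -setI_eq0 finset.setI0 eqxx.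
Qed.

(** Markov's inequality for the size of the core. *)
Lemma prob_small_core (R : realType) (G : sgraph) (thr thr' a e : R) :
  thr <= thr' -> 0 < a -> (0 < #|G|)%N ->
  expect (fun F : {set {set G}} => #|core thr F|%:R) <= #|G|%:R * (a * e) ->
  1 - e <= prob_Gp (1 / 2) G (fun Gp : sgraph =>
    [forall S : {set Gp}, (thr' <= (min_degree (induced_subgraph S))%:R) ==>
       (#|induced_subgraph S|%:R / #|G|%:R <= a)]).
Proof.
move=> le_thr a0 G0 small; rewrite prob_half.
have G0' : 0 < #|G|%:R :> R by rewrite ltr0n.
have Ga0 : 0 < #|G|%:R * a by rewrite mulr_gt0.
apply: le_trans (_ : expect (fun F : {set {set G}} =>
    1 + - (#|G|%:R * a)^-1 * #|core thr F|%:R) <= _).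
  rewrite expectD expect1 expectZ lerD2l mulNr lerN2 ler_pdivrMl //.
  by rewrite -mulrA.
apply: expect_le => F _; case: (boolP [forall S, _]) => [_|].
  by rewrite gerDl mulNr oppr_le0 mulr_ge0 // invr_ge0 ltW.
rewrite negb_forall => /existsP[S]; rewrite negb_imply -ltNge => /andP[thrS big].
rewrite mulNr subr_le0 ler_pdivlMl // mulr1 mulrC -ler_pdivlMr //.
apply: le_trans (ltW big) _; rewrite ler_pM2r ?invr_gt0 // ler_nat card_sig.
apply: subset_leq_card; apply: min_degree_sub_core.
exact: le_trans thrS.
Qed.

Local Open Scope classical_set_scope.
Local Open Scope ring_scope.

Theorem theorem1p5 (R : realType) (alpha : R) (alpha_gt0 : 0 < alpha) :
  exists (beta C : R) (K : set nat) (eps : nat -> R),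
    [/\ 0 < beta < 1, 0 < C, infinite_set K,
        (forall k, K k -> 0 <= eps k <= 1) /\
        eps k @[k --> within K \oo] --> (0 : R) &
      forall k : nat, K k -> forall N : nat, exists G : sgraph,
        [/\ regular_graph k G, (N <= #|G|)%N &
          1 - eps k <= prob_Gp (1 / 2) G (fun Gp : sgraph =>
            [forall S : {set Gp},
              (k%:R / 4 + alpha * k%:R <= (min_degree (induced_subgraph S))%:R) ==>
              (#|induced_subgraph S|%:R / #|G|%:R <= C * (1 - beta) ^+ (k ^ 2)%N)])]].
Proof.
pose a := Num.min alpha 1.
have a0 : 0 < a by rewrite lt_min alpha_gt0 ltr01.
have a1 : a <= 1 by rewrite ge_min lexx orbT.
have a_le : a <= alpha by rewrite ge_min lexx.
pose r := (Num.truncn a^-1).+1.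
have r0 : (0 < r)%N by [].
have ra : 1 <= r%:R * a.
  have /andP[_ /ltW le] : (Num.truncn a^-1)%:R <= a^-1 < r%:R.
    by apply: Num.Theory.truncn_itv; rewrite invr_ge0 ltW.
  by rewrite -ler_pdivrMr // mul1r.
have [h [t0 [C [rate [h0 t00 C0 rate0 small]]]]] := failure_small a0 a1 r0.
have r2 : 0 < r%:R ^+ 2 :> R by rewrite exprn_gt0 // ltr0n.
pose s := rate / (8 * r%:R ^+ 2).
have s0 : 0 < s by rewrite divr_gt0 // mulr_gt0.
pose z := expR (- s); have z0 : 0 < z by exact: expR_gt0.
have z1 : z < 1 by rewrite -expR0 ltr_expR oppr_lt0.
pose deg i := (2 * r * (t0 + i))%N.
exists (1 - z), C, [set k | exists i, k = deg i], (fun k => z ^+ (k ^ 2)%N).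
rewrite subKr; split => //.
- by apply/andP; split; lra.
- move=> fin; apply: infinite_nat.
  suff -> : [set: nat] = deg @^-1` [set k | exists i, k = deg i].
    apply: finite_preimage => // i j _ _ /eqP.
    by rewrite /deg eqn_pmul2l // eqn_add2l => /eqP.
  by apply/seteqP; split=> // i _; exists i.
- split=> [k _|]; first by rewrite exprn_ge0 ?exprn_ile1 // ltW.
  have le_sqr n : (n <= n ^ 2)%N by case: n => // n; rewrite -mulnn leq_pmulr.
  apply: cvg_within_filter.
  apply: (@squeeze_cvgr _ _ _ _ (fun=> 0) (fun k => z ^+ k)).
  + near=> k; rewrite exprn_ge0 ?(ltW z0) //=.
    by apply: ler_wiXn2l; rewrite ?(ltW z0) ?(ltW z1).
  + exact: cvg_cst.
  + by apply: cvg_expr; rewrite gtr0_norm.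
move=> k [i ->] N; set t := (t0 + i)%N.
have t_gt0 : (0 < t)%N by rewrite addn_gt0 t00.
have [m m9 fail] := small t (leq_addr _ _).
exists (helix t N r0 h0 m9).
have card_ge : (N < #|helix t N r0 h0 m9|)%N.
  have W0 : (0 < pitch r h ^ 2)%N.
    by rewrite expn_gt0 muln_gt0 h0 expn_gt0 addn_gt0 orbT.
  rewrite card_helix -mulnA leq_pmulr // muln_gt0 t_gt0 andbT muln_gt0 W0 andbT.
  exact: leq_trans m9.
split; [exact: blowup_regular (@helix_nb_inj _ _ _ _ r0 h0 m9) | exact: ltnW |].
apply: (@prob_small_core _ _ (threshold r t a)).
- by rewrite /threshold lerD2l; apply: ler_wpM2r.
- by rewrite mulr_gt0 // exprn_gt0.
- exact: leq_ltn_trans card_ge.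
apply: le_trans (expect_core N r0 h0 m9 a0 a1 ra t_gt0) _.
apply: ler_wpM2l => //; apply: le_trans fail _; rewrite -mulrA.
apply: ler_wpM2l; first exact: ltW.
rewrite -expRM_natl -expRD ler_expR /s /deg natrX !natrM -/t.
rewrite le_eqVlt; apply/orP; left; apply/eqP; field.
by rewrite lt0r_neq0 // ltr0n.
Unshelve. all: by end_near.
Qed.
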